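(* Let $r\ge2$ and $\mathbf a=(a_2,\dots,a_r)\in\mathbb R^{r-1}$ with $a_r\ne0$. If $\mathcal N_{\mathbf a}\subseteq\mathbb R$, then the sequence $(c_n(\mathbf a))_{n\ge0}$ is positive definite.
   Context: The sequence $c_n(\mathbf a)$ is defined by $c_0(\mathbf a)=1$ and, for $n\ge1$, $c_n(\mathbf a)=\sum_{j=2}^r a_j\sum_{u_1+\dots+u_j=n-j+1,\ u_i\ge0}c_{u_1}(\mathbf a)\cdots c_{u_j}(\mathbf a)$. Let $P_{\mathbf a}(w)=w-a_2w^2-\dots-a_rw^r$, and let $\mathcal N_{\mathbf a}$ be the set of all $z\in\mathbb C$ such that $P_{\mathbf a}(w)-z$ has a multiple root in $w$. A real sequence $(c_n)_{n\ge0}$ is positive definite if $\sum_{i,j\ge0}c_{i+j}x_ix_j\ge0$ for every real sequence $(x_i)$ with finitely many nonzero terms; equivalently, there is a positive measure $\mu$ on $\mathbb R$ with $c_n=\int t^n\mu(dt)$ for all $n\ge0$. *)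

(* Defs.v *)
From HB Require Import structures.
From mathcomp Require Import all_boot all_order all_algebra.
From mathcomp Require Import complex.
From mathcomp Require Import classical_sets reals.

Set Implicit Arguments.
Unset Strict Implicit.
Unset Printing Implicit Defensive.

Import Order.TTheory GRing.Theory Num.Theory.

Local Open Scope classical_set_scope.
Local Open Scope ring_scope.
Local Open Scope complex_scope.

(* Throughout, the vector (a_2, ..., a_r) is a function [a : nat -> R] of which
   only the values at 2, ..., r are used. *)

(* The right-hand side of the recurrence for the n-th term of c(a).
   The equation u_1 + ... + u_j = n - j + 1 is written without subtraction,
   so that there is no u when j > n + 1. As j >= 2, it forces u_i <= n - 1,
   so that letting u_i range over 'I_n loses nothing. *)
Definition c_step (R : realType) (r : nat) (a : nat -> R) (c : nat -> R)
    (n : nat) : R :=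
  \sum_(2 <= j < r.+1)
     a j * \sum_(u : {ffun 'I_j -> 'I_n} | (\sum_i u i + j == n + 1)%N)
              \prod_i c (u i).

(* c_prefix r a n = [:: c_0(a); ...; c_n(a)] *)
Fixpoint c_prefix (R : realType) (r : nat) (a : nat -> R) (n : nat) : seq R :=
  if n is m.+1 then
    let s := c_prefix r a m in rcons s (c_step r a (nth 0 s) m.+1)
  else [:: 1].

Definition c_seq (R : realType) (r : nat) (a : nat -> R) (n : nat) : R :=
  nth 0 (c_prefix r a n) n.

Lemma size_c_prefix (R : realType) (r : nat) (a : nat -> R) (n : nat) :
  size (c_prefix r a n) = n.+1.
Proof. by elim: n => //= n IHn; rewrite size_rcons IHn. Qed.

Lemma nth_c_prefix (R : realType) (r : nat) (a : nat -> R) (n k : nat) :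
  (k <= n)%N -> nth 0 (c_prefix r a n) k = c_seq r a k.
Proof.
elim: n => [|n IHn]; first by rewrite leqn0 => /eqP->.
rewrite leq_eqVlt => /predU1P[->//|]; rewrite ltnS => lekn.
by rewrite /= nth_rcons size_c_prefix ltnS lekn IHn.
Qed.

Lemma c_seq0 (R : realType) (r : nat) (a : nat -> R) : c_seq r a 0 = 1.
Proof. by []. Qed.

Lemma c_seqE (R : realType) (r : nat) (a : nat -> R) (n : nat) :
  (1 <= n)%N -> c_seq r a n = c_step r a (c_seq r a) n.
Proof.
case: n => // n _; rewrite {1}/c_seq /= nth_rcons size_c_prefix ltnn eqxx.
apply: eq_bigr => j _; congr (_ * _); apply: eq_bigr => u _.
by apply: eq_bigr => i _; rewrite nth_c_prefix // -ltnS.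
Qed.

Definition P_poly (R : realType) (r : nat) (a : nat -> R) : {poly R[i]} :=
  'X - \sum_(2 <= j < r.+1) (a j)%:C *: 'X^j.

(* [mup w q] is only meaningful for q != 0; here q always has the coefficient
   1 in degree 1. *)
Definition N_set (R : realType) (r : nat) (a : nat -> R) : set R[i] :=
  [set z | exists w : R[i], (2 <= mup w (P_poly r a - z%:P))%N].

Definition positive_definite (R : realType) (c : nat -> R) : Prop :=
  forall (x : nat -> R) (m : nat), (forall i, (m <= i)%N -> x i = 0) ->
    0 <= \sum_(i < m) \sum_(j < m) c (i + j)%N * x i * x j.

(* Main.v *)
(* Let f be the power series with f(z) = sum c_n z^(n+1). The recurrence says
   P(f(z)) = z, and if all critical values of P are real, then f continues
   analytically to the upper half plane and maps it into itself, so that f is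
   the moment generating function of a positive measure. To make this
   elementary, substitute z = kappa q / (1 + q^2) with kappa > 0 so small that
   z avoids the nonzero critical values on 0 < |q| < 1. The resulting series
   g(q) has coefficients L(V_k), where L is the moment functional and V_k the
   Chebyshev polynomials of the second kind. A quantitative implicit function
   theorem, applied around each point of a circle |q| = rho, bounds the Taylor
   coefficients there uniformly; averaging over roots of unity turns this into
   a bound on the coefficients of g with a larger rho, so that g converges on
   the whole unit disc. There Im g(q) has the sign of Im q, since P(g(q)) is
   real only for real q; averaging Q(2 Re e) Im e Im g(rho e) over roots of
   unity e and letting rho tend to 1 gives L(Q) >= 0 for every Q >= 0. Only
   the truncations G_N of g are ever evaluated. *)

Require Import Defs.
From mathcomp Require Import all_boot all_order all_algebra.
From mathcomp Require Import cyclic separable cyclotomic polyrcf complex.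
From mathcomp Require Import classical_sets reals.
From mathcomp Require Import ring lra zify.

Set Implicit Arguments.
Unset Strict Implicit.
Unset Printing Implicit Defensive.

Import Order.TTheory GRing.Theory Num.Theory.

Local Open Scope classical_set_scope.
Local Open Scope ring_scope.
Local Open Scope complex_scope.

Local Notation nc := ComplexField.Normc.normc.
Local Notation Re := complex.Re.
Local Notation Im := complex.Im.

(** * Weighted coefficient norms of complex polynomials *)

Section ComplexModulus.
Variable R : rcfType.
Implicit Types (x y : R[i]) (p q : {poly R[i]}) (s t : R).

Lemma nc_norm x : `|x| = (nc x)%:C.
Proof. by []. Qed.

Lemma nc0 : nc (0 : R[i]) = 0. Proof. exact: ComplexField.Normc.normc0. Qed.
Lemma nc1 : nc (1 : R[i]) = 1. Proof. exact: ComplexField.Normc.normc1. Qed.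
Lemma ncM x y : nc (x * y) = nc x * nc y.
Proof. exact: ComplexField.Normc.normcM. Qed.
Lemma ncV x : nc x^-1 = (nc x)^-1.
Proof. exact: ComplexField.Normc.normcV. Qed.
Lemma nc_eq0 x : (nc x == 0) = (x == 0).
Proof. by apply/eqP/eqP => [/ComplexField.Normc.eq0_normc //|->]; rewrite nc0. Qed.
Lemma nc_ge0 x : 0 <= nc x.
Proof. by case: x => a b; apply: sqrtr_ge0. Qed.
Lemma nc_gt0 x : (0 < nc x) = (x != 0).
Proof. by rewrite lt_def nc_eq0 nc_ge0 andbT. Qed.
Lemma ncD x y : nc (x + y) <= nc x + nc y.
Proof. by have := ler_normD x y; rewrite !nc_norm -rmorphD /= lecR. Qed.
Lemma ncN x : nc (- x) = nc x.
Proof. by apply: complexI; rewrite -!nc_norm normrN. Qed.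
Lemma nc_subC x y : nc (x - y) = nc (y - x).
Proof. by rewrite -ncN opprB. Qed.
Lemma ncBl x y : nc x - nc y <= nc (x - y).
Proof. by rewrite lerBlDr -{1}(subrK y x) ncD. Qed.
Lemma ncX x n : nc (x ^+ n) = nc x ^+ n.
Proof. by elim: n => [|n IH]; rewrite ?nc1 // !exprS ncM IH. Qed.
Lemma nc_real (s : R) : 0 <= s -> nc s%:C = s.
Proof. by move=> s0; apply: complexI; rewrite -nc_norm ger0_norm // ler0c. Qed.
Lemma nc_realN (s : R) : nc s%:C = `|s|.
Proof.
case: (ger0P s) => s0; first by rewrite nc_real.
by rewrite -ncN -rmorphN nc_real //= oppr_ge0 ltW.
Qed.
Lemma nc_sum I (r : seq I) (P : pred I) (F : I -> R[i]) :
  nc (\sum_(i <- r | P i) F i) <= \sum_(i <- r | P i) nc (F i).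
Proof.
elim/big_rec2: _ => [|i a b _ le_ba]; first by rewrite nc0.
by apply: le_trans (ncD _ _) _; rewrite lerD2l.
Qed.
Lemma nc_Im x : `|Im x| <= nc x.
Proof.
case: x => a b /=; rewrite -sqrtr_sqr ler_sqrt ?lerDr ?addr_ge0 ?sqr_ge0 //.
Qed.
Lemma nc_Re x : `|Re x| <= nc x.
Proof.
case: x => a b /=; rewrite -sqrtr_sqr ler_sqrt ?lerDl ?addr_ge0 ?sqr_ge0 //.
Qed.
Lemma nc_sqr x : nc x ^+ 2 = Re x ^+ 2 + Im x ^+ 2.
Proof. by case: x => a b /=; rewrite sqr_sqrtr // addr_ge0 ?sqr_ge0. Qed.

(** The weighted l1 norm of the coefficients. It dominates the modulus on the disc of radius [s] and
    is submultiplicative, so products, compositions and shifts of the centre are estimated without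
    any analysis. *)
Definition wnorm s p : R := \sum_(i < size p) nc p`_i * s ^+ i.

Lemma wnormE n s p : (size p <= n)%N ->
  wnorm s p = \sum_(i < n) nc p`_i * s ^+ i.
Proof.
move=> le_pn; rewrite /wnorm (big_ord_widen n (fun i => nc p`_i * s ^+ i)) //.
rewrite big_mkcond; apply: eq_bigr => i _; case: ltnP => // le_pi.
by rewrite nth_default // nc0 mul0r.
Qed.

Lemma wnorm_ge0 s p : 0 <= s -> 0 <= wnorm s p.
Proof. by move=> s0; apply: sumr_ge0 => i _; rewrite mulr_ge0 ?nc_ge0 ?exprn_ge0. Qed.

Lemma wnorm0 s : wnorm s 0 = 0.
Proof. by rewrite /wnorm size_poly0 big_ord0. Qed.

Lemma wnormZ s c p : wnorm s (c *: p) = nc c * wnorm s p.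
Proof.
rewrite (wnormE (n := size p)) ?size_scale_leq // mulr_sumr.
by apply: eq_bigr => i _; rewrite coefZ ncM mulrA.
Qed.

Lemma wnormD s p q : 0 <= s -> wnorm s (p + q) <= wnorm s p + wnorm s q.
Proof.
move=> s0; set n := maxn (size p) (size q).
rewrite (@wnormE n) ?size_polyD // (@wnormE n s p) ?leq_maxl //.
rewrite (@wnormE n s q) ?leq_maxr // -big_split /=; apply: ler_sum => i _.
by rewrite coefD -mulrDl ler_wpM2r ?exprn_ge0 ?ncD.
Qed.

Lemma wnormN s p : wnorm s (- p) = wnorm s p.
Proof. by rewrite -scaleN1r wnormZ ncN nc1 mul1r. Qed.

Lemma wnormB s p q : 0 <= s -> wnorm s (p - q) <= wnorm s p + wnorm s q.
Proof. by move=> s0; rewrite -(wnormN s q) wnormD. Qed.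

Lemma wnorm_sum s I (r : seq I) (P : pred I) (F : I -> {poly R[i]}) : 0 <= s ->
  wnorm s (\sum_(i <- r | P i) F i) <= \sum_(i <- r | P i) wnorm s (F i).
Proof.
move=> s0; elim/big_rec2: _ => [|i a b _ le_ba]; first by rewrite wnorm0.
by apply: le_trans (wnormD _ _ s0) _; rewrite lerD2l.
Qed.

Lemma wnormC s c : wnorm s c%:P = nc c.
Proof.
rewrite (wnormE (n := 1)) ?size_polyC_leq1 // big_ord1 coefC eqxx.
by rewrite expr0 mulr1.
Qed.

Lemma wnormXM s p : wnorm s ('X * p) = s * wnorm s p.
Proof.
rewrite (wnormE (n := (size p).+1)); last first.
  by rewrite mulrC; have [->|p0] := eqVneq p 0; rewrite ?mul0r ?size_poly0 // size_mulX.
rewrite big_ord_recl coefXM nc0 mul0r add0r mulr_sumr; apply: eq_bigr => i _.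
by rewrite coefXM /= exprS; ring.
Qed.

Lemma wnormXnM s n p : wnorm s ('X^n * p) = s ^+ n * wnorm s p.
Proof.
by elim: n => [|n IH]; rewrite ?expr0 ?mul1r // !exprS -mulrA wnormXM IH mulrA.
Qed.

Lemma wnormX s : wnorm s 'X = s.
Proof. by rewrite -['X]mulr1 wnormXM -polyC1 wnormC nc1 mulr1. Qed.

Lemma wnormM s p q : 0 <= s -> wnorm s (p * q) <= wnorm s p * wnorm s q.
Proof.
move=> s0; rewrite -[X in X * q]coefK poly_def mulr_suml.
apply: le_trans (wnorm_sum _ _ _ s0) _; rewrite [X in _ <= X * _]/wnorm mulr_suml.
by apply: ler_sum => i _; rewrite -scalerAl wnormZ wnormXnM mulrA.
Qed.

Lemma wnorm_exp s p n : 0 <= s -> wnorm s (p ^+ n) <= wnorm s p ^+ n.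
Proof.
move=> s0; elim: n => [|n IH]; first by rewrite !expr0 -polyC1 wnormC nc1.
rewrite !exprS; apply: le_trans (wnormM _ _ s0) _.
by rewrite ler_wpM2l ?wnorm_ge0.
Qed.

Lemma wnorm_comp s p q : 0 <= s -> wnorm s (p \Po q) <= wnorm (wnorm s q) p.
Proof.
move=> s0; rewrite comp_polyE; apply: le_trans (wnorm_sum _ _ _ s0) _.
by apply: ler_sum => i _; rewrite wnormZ ler_wpM2l ?nc_ge0 ?wnorm_exp.
Qed.

Lemma wnorm_le s t p : 0 <= s -> s <= t -> wnorm s p <= wnorm t p.
Proof.
move=> s0 st; apply: ler_sum => i _; rewrite ler_wpM2l ?nc_ge0 //.
by rewrite lerXn2r // nnegrE (le_trans s0).
Qed.

Lemma wnorm_shift s c p : 0 <= s ->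
  wnorm s (p \Po ('X + c%:P)) <= wnorm (s + nc c) p.
Proof.
move=> s0; apply: le_trans (wnorm_comp _ _ s0) _.
apply: wnorm_le; first exact: wnorm_ge0.
by apply: le_trans (wnormD _ _ s0) _; rewrite wnormX wnormC.
Qed.

Lemma nc_horner p x : nc p.[x] <= wnorm (nc x) p.
Proof.
rewrite horner_coef; apply: le_trans (nc_sum _ _ _) _.
by apply: ler_sum => i _; rewrite ncM ncX.
Qed.

Lemma coef_le_wnorm s p k : 0 <= s -> nc p`_k * s ^+ k <= wnorm s p.
Proof.
move=> s0; rewrite (wnormE (n := maxn (size p) k.+1)) ?leq_maxl //.
have lt_k : (k < maxn (size p) k.+1)%N by rewrite leq_max ltnSn orbT.
rewrite (bigD1 (Ordinal lt_k)) //= lerDl sumr_ge0 // => i _.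
by rewrite mulr_ge0 ?nc_ge0 ?exprn_ge0.
Qed.

Lemma wnorm_take_le s p n : 0 <= s -> wnorm s (take_poly n p) <= wnorm s p.
Proof.
move=> s0; rewrite (wnormE (n := size p)).
  apply: ler_sum => i _; rewrite coef_take_poly; case: ifP => // _.
  by rewrite nc0 mul0r mulr_ge0 ?nc_ge0 ?exprn_ge0.
apply/leq_sizeP => j le_pj; rewrite coef_take_poly nth_default //.
by case: ifP.
Qed.

(** A Schwarz lemma: factoring out ['X^n] gains (s/t)^n when passing from radius [t] to the smaller
    radius [s]. *)
Lemma wnorm_drop s t p n : 0 <= s -> s <= t ->
  (forall i, (i < n)%N -> p`_i = 0) -> wnorm s p * t ^+ n <= s ^+ n * wnorm t p.
Proof.
move=> s0 st p0; have t0 := le_trans s0 st.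
have -> : p = 'X^n * drop_poly n p.
  rewrite -[LHS](poly_take_drop n) commr_polyXn.
  suff -> : take_poly n p = 0 by rewrite add0r.
  apply/polyP => i; rewrite coef_take_poly coef0; case: ifP => // lt_in.
  exact: p0.
rewrite !wnormXnM -mulrA ler_wpM2l ?exprn_ge0 //.
by rewrite mulrC ler_wpM2l ?exprn_ge0 ?wnorm_le.
Qed.
End ComplexModulus.

(** * Roots of unity and Cauchy estimates *)

Section RootsOfUnity.
Variable R : rcfType.
Implicit Types (z w x : R[i]) (p : {poly R[i]}).

(** The polynomial X^n - 1 splits and is separable, so it has n distinct roots, and one of them is
    primitive. *)
Lemma complex_prim_root_exists n : (0 < n)%N ->
  exists z : R[i], n.-primitive_root z.
Proof.
move=> n_gt0; pose p : {poly R[i]} := 'X^n - 1.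
have [r Dp] := closed_field_poly_normal p.
rewrite (monicP _) ?monicXnsubC // scale1r in Dp.
have rn1 : all n.-unity_root r by apply/allP => z; rewrite -root_prod_XsubC -Dp.
have sz_r : (n < (size r).+1)%N.
  by rewrite -(size_prod_XsubC r id) -Dp size_XnsubC.
have [|z] := hasP (has_prim_root n_gt0 rn1 _ sz_r); last by exists z.
by rewrite -separable_prod_XsubC -Dp separable_Xn_sub_1 // pnatr_eq0 -lt0n.
Qed.

Lemma nc_unity n z : (0 < n)%N -> z ^+ n = 1 -> nc z = 1.
Proof.
move=> n_gt0 zn1; apply/eqP; rewrite -(@pexpr_eq1 _ _ n) ?nc_ge0 //.
by rewrite -ncX zn1 nc1.
Qed.

Lemma sum_expr_unity n w : w ^+ n = 1 ->
  \sum_(j < n) w ^+ j = if w == 1 then n%:R else 0.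
Proof.
move=> wn1; case: eqP => [->|/eqP w1].
  by under eq_bigr do rewrite expr1n; rewrite sumr_const card_ord.
apply: (mulfI (x := w - 1)); first by rewrite subr_eq0.
by rewrite -subrX1 wn1 subrr mulr0.
Qed.

(* Averaging over the n-th roots of unity, n > deg p, isolates a coefficient. *)
Lemma cauchy_estimate p (s M : R) k : 0 <= s ->
  (forall x, nc x = s -> nc p.[x] <= M) -> nc p`_k * s ^+ k <= M.
Proof.
move=> s0 le_pM; pose n := (maxn (size p) k.+1).
have n_gt0 : (0 < n)%N by rewrite leq_max orbT.
have lt_kn : (k < n)%N by rewrite leq_max leqnn orbT.
have [z zP] := complex_prim_root_exists n_gt0.
have zn1 := prim_expr_order zP; have nz := nc_unity n_gt0 zn1.
have z0 : z != 0 by rewrite -nc_gt0 nz ltr01.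
have E : \sum_(j < n) p.[s%:C * z ^+ j] * (z ^- k) ^+ j
    = n%:R * (p`_k * s%:C ^+ k).
  transitivity (\sum_(i < n) p`_i * s%:C ^+ i * \sum_(j < n) (z ^+ i / z ^+ k) ^+ j).
    under eq_bigr => j _ do rewrite (horner_coef_wide _ (leq_maxl _ k.+1)) mulr_suml.
    rewrite exchange_big; apply: eq_bigr => i _; rewrite mulr_sumr.
    apply: eq_bigr => j _; rewrite !exprMn -!exprM mulnC; ring.
  rewrite (bigD1 (Ordinal lt_kn)) //= [X in _ + X]big1 => [|i ne_ik].
    rewrite addr0 divff ?expf_neq0 //.
    by under eq_bigr do rewrite expr1n; rewrite sumr_const card_ord mulrC.
  rewrite sum_expr_unity; last first.
    by rewrite exprMn exprVn -!exprM ![(_ * n)%N]mulnC !exprM zn1 !expr1n divr1.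
  case: eqP => [/divr1_eq/eqP|_]; last by rewrite mulr0.
  by rewrite (eq_prim_root_expr zP) !modn_small // => /eqP e; case/eqP: ne_ik; apply: val_inj.
have n0 : 0 < n%:R :> R by rewrite ltr0n.
rewrite -(ler_pM2l n0) -{1}(nc_real (ltW n0)) -{1}(nc_real s0) -ncX -!ncM.
rewrite rmorph_nat -E; apply: le_trans (nc_sum _ _ _) _.
apply: (@le_trans _ _ (\sum_(j < n) M)); last by rewrite sumr_const card_ord mulr_natl.
apply: ler_sum => j _; rewrite ncM ncX ncV ncX nz expr1n invr1 expr1n mulr1.
by apply: le_pM; rewrite ncM ncX nz expr1n mulr1 nc_real.
Qed.
End RootsOfUnity.

(** * Chebyshev polynomials of the second kind *)

Section Chebyshev.
Variable R : rcfType.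
Implicit Types (Q : {poly R}) (e : R[i]).

(* V_k (t + 1/t) = (t^k - t^-k) / (t - 1/t) *)
Fixpoint chebV2 (k : nat) : {poly R} * {poly R} :=
  if k is k'.+1 then let: (u, v) := chebV2 k' in (v, 'X * v - u) else (0, 1).
Definition chebV k := (chebV2 k).1.

Lemma chebV0 : chebV 0 = 0. Proof. by []. Qed.
Lemma chebV1 : chebV 1 = 1. Proof. by []. Qed.
Lemma chebVSS k : chebV k.+2 = 'X * chebV k.+1 - chebV k.
Proof. by rewrite /chebV /=; case: (chebV2 k). Qed.

Lemma nat_ind2 (P : nat -> Prop) :
  P 0%N -> P 1%N -> (forall k, P k -> P k.+1 -> P k.+2) -> forall k, P k.
Proof.
move=> P0 P1 PS k; suff [] : P k /\ P k.+1 by [].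
by elim: k => [|k [IH1 IH2]]; split=> //; apply: PS.
Qed.

Lemma size_chebV k : size (chebV k) = k /\ lead_coef (chebV k.+1) = 1.
Proof.
elim/nat_ind2: k => [||k [IH1 IH2] [IH3 IH4]].
- by rewrite chebV0 size_poly0 chebV1 lead_coef1.
- rewrite chebV1 chebVSS chebV0 chebV1 subr0 mulr1 lead_coefX size_poly1 //.
have sX : size ('X * chebV k.+1) = k.+2.
  by rewrite mulrC size_mulX ?IH3 // -size_poly_eq0 IH3.
have sS : size (chebV k.+2) = k.+2.
  by rewrite chebVSS size_polyDl sX // size_polyN IH1.
split=> //; rewrite chebVSS lead_coefDl.
  by rewrite mulrC lead_coefMX.
by rewrite size_polyN IH3 mulrC size_mulX ?sS // -size_poly_eq0 sS.
Qed.

Lemma chebV_horner e k : e != 0 ->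
  (map_poly (real_complex R) (chebV k)).[e + e^-1] * (e - e^-1) = e ^+ k - e ^- k.
Proof.
move=> e0; elim/nat_ind2: k => [||k IH1 IH2].
- by rewrite chebV0 rmorph0 horner0 mul0r !expr0 invr1 subrr.
- by rewrite chebV1 rmorph1 hornerC mul1r !expr1.
rewrite chebVSS rmorphB rmorphM /= map_polyX hornerD hornerN hornerM hornerX.
rewrite mulrDl mulNr -mulrA IH1 IH2 !exprS; field.
by rewrite e0 expf_neq0.
Qed.

(** V_(k+1) is monic of degree k, so leading terms can be removed one after the other. *)
Lemma chebV_span Q : exists d : nat -> R,
  Q = \sum_(k < size Q) d k *: chebV k.+1.
Proof.
move: {2}(size Q) (leqnn (size Q)) => n; elim: n Q => [|n IH] Q.
  by rewrite leqn0 size_poly_eq0 => /eqP ->; exists (fun=> 0); rewrite size_poly0 big_ord0.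
move=> sQ; have [sQn|] := leqP (size Q) n; first exact: IH.
move=> ltnQ; have {ltnQ}sQ : size Q = n.+1 by apply/eqP; rewrite eqn_leq sQ ltnQ.
pose Q' := Q - lead_coef Q *: chebV n.+1.
have [sV lV] : size (chebV n.+1) = n.+1 /\ (chebV n.+1)`_n = 1.
  have [-> _] := size_chebV n.+1; have [_ <-] := size_chebV n; split=> //.
  by rewrite lead_coefE; have [-> _] := size_chebV n.+1.
have sQ' : (size Q' <= n)%N.
  apply/leq_sizeP => j; rewrite leq_eqVlt coefB coefZ => /predU1P[<-|lt_nj].
    by rewrite lV lead_coefE sQ mulr1 subrr.
  by rewrite !nth_default ?sV ?sQ // mulr0 subrr.
have [d dP] := IH _ sQ'.
exists (fun k => if (k < size Q')%N then d k else if k == n then lead_coef Q else 0).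
rewrite sQ big_ord_recr /= eqxx ltnNge sQ' /= -[LHS](subrK (lead_coef Q *: chebV n.+1)).
congr (_ + _); rewrite -/Q' {1}dP.
rewrite (big_ord_widen n (fun k => d k *: chebV k.+1)) // big_mkcond.
by apply: eq_bigr => i _; case: ifP => // _; rewrite ltn_eqF // scale0r.
Qed.
End Chebyshev.

(** * Real polynomials at complex points and at an endpoint *)

Section RealPolynomials.
Variable R : rcfType.
Implicit Types (p : {poly R}) (x : R[i]).
Local Notation cpoly := (map_poly (real_complex R)).

Lemma horner_conj p x : (cpoly p).[x^*] = (cpoly p).[x]^*.
Proof.
rewrite !horner_coef rmorph_sum; apply: eq_bigr => i _.
by rewrite rmorphM rmorphXn coef_map; congr (_ * _); rewrite /= oppr0.
Qed.

Lemma horner_real p (t : R) : (cpoly p).[t%:C] = p.[t]%:C.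
Proof. by rewrite horner_map. Qed.

Lemma poly_ge0_at1 p : (forall t, 0 < t < 1 -> 0 <= p.[t]) -> 0 <= p.[1].
Proof.
move=> p_ge0; rewrite leNgt; apply/negP => p1.
have [d d0 dP] := poly_cont 1 p (e := - p.[1]) (ltac:(lra)).
pose t := 1 - Num.min (d / 2) (1 / 2).
have m0 : 0 < Num.min (d / 2) (1 / 2) by rewrite lt_min; apply/andP; split; lra.
have m1 : Num.min (d / 2) (1 / 2) <= 1 / 2 by rewrite ge_min lexx orbT.
have m2 : Num.min (d / 2) (1 / 2) <= d / 2 by rewrite ge_min lexx.
have t01 : 0 < t < 1 by rewrite /t; lra.
have := p_ge0 t t01; have := dP t; rewrite /t addrAC subrr add0r normrN gtr0_norm //.
by move=> /(_ ltac:(lra)); rewrite ltr_norml -/t => /andP[]; lra.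
Qed.
End RealPolynomials.

(** * Decay and sums of geometric progressions *)

Section GeometricSums.
Variable R : realType.
Implicit Types (x A e : R).

(** Bernoulli's inequality for the powers of 1/x, combined with the Archimedean property. *)
Lemma geom_small x A e : 0 <= x < 1 -> 0 < e ->
  exists K, forall n, (K <= n)%N -> A * x ^+ n <= e.
Proof.
move=> /andP[x0 x1] e0; have [->|xn0] := eqVneq x 0.
  by exists 1%N => -[//|n] _; rewrite expr0n mulr0 ltW.
have xp : 0 < x by rewrite lt_def xn0.
have [A0|A0] := lerP A 0.
  exists 0%N => n _; apply: le_trans (ltW e0); rewrite -(mul0r (x ^+ n)).
  by rewrite ler_wpM2r // exprn_ge0.
pose h := x^-1 - 1.
have h0 : 0 < h by rewrite /h subr_gt0 invf_gt1.
have bern n : 1 + n%:R * h <= x^-1 ^+ n.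
  elim: n => [|n IH]; first by rewrite mul0r addr0.
  rewrite exprSr; have -> : x^-1 = 1 + h by rewrite /h; ring.
  have : (1 + n%:R * h) * (1 + h) <= x^-1 ^+ n * (1 + h) by rewrite ler_wpM2r //; lra.
  have -> : x^-1 = 1 + h by rewrite /h; ring.
  have : 0 <= n%:R * h * h by rewrite !mulr_ge0 // ltW.
  rewrite mulrS; nra.
have q0 : 0 <= A / (e * h) by rewrite divr_ge0 ?mulr_ge0 // ltW.
exists (Num.bound (A / (e * h))) => n le_n.
have := archi_boundP q0; set b := _%:R => ltb.
have le_b : b <= n%:R by rewrite ler_nat.
have := bern n; rewrite exprVn => le_xn.
have xn : 0 < x ^+ n by rewrite exprn_gt0.
rewrite -ler_pdivlMr //; apply: le_trans (_ : e * (1 + n%:R * h) <= _); last first.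
  by rewrite ler_pM2l.
have : A <= e * h * b by rewrite mulrC -ler_pdivrMr ?mulr_gt0 // ltW.
have : e * h * b <= e * h * n%:R by rewrite ler_pM2l ?mulr_gt0.
by rewrite [e * (1 + _)]mulrDr mulr1 -mulrA [n%:R * h]mulrC mulrA; lra.
Qed.

Lemma geom_sum_le x n : 0 <= x < 1 -> \sum_(i < n) x ^+ i <= (1 - x)^-1.
Proof.
move=> /andP[x0 x1]; have y0 : 0 < 1 - x by rewrite subr_gt0.
rewrite -(ler_pM2l y0) mulfV ?gt_eqF //.
have := subrX1 x n; have := exprn_ge0 n x0; move: (\sum_(i < n) _) => S; nra.
Qed.
End GeometricSums.

(** * Positivity of the moment functional from the sign of Im g *)

Section TypicallyReal.
Variable R : realType.
Variables (b g : nat -> R).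
Local Notation cpoly := (map_poly (real_complex R)).
Let G N := \poly_(k < N.+1) (g k).

Hypothesis gE : forall k, g k = \sum_(n < k) (chebV R k)`_n * b n.
Hypothesis g_growth : forall s, 0 < s < 1 -> exists C, forall k, `|g k| * s ^+ k <= C.
Hypothesis G_Im : forall q : R[i], nc q < 1 -> 0 < Im q ->
  exists N0, forall N, (N0 <= N)%N -> 0 <= Im (cpoly (G N)).[q].

(** With [t] between [s] and 1, the terms are at most C (s/t)^i on |q| <= s, so the truncations are
    uniformly Cauchy there. *)
Lemma growth_tail s e : 0 < s < 1 -> 0 < e -> exists K0, forall K N (q : R[i]),
  (K0 <= K)%N -> (K <= N)%N -> nc q <= s ->
  nc ((cpoly (G N)).[q] - (cpoly (G K)).[q]) <= e.
Proof.
move=> s01 e0; pose t := (1 + s) / 2.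
have t01 : 0 < t < 1 by rewrite /t; lra.
have [C CP] := g_growth t01.
have t0 : 0 < t by lra.
pose x := s / t.
have x0 : 0 < x by rewrite divr_gt0 //; lra.
have x1 : x < 1 by rewrite ltr_pdivrMr // mul1r /t; lra.
have [K0 K0P] := @geom_small R x (C / (1 - x)) e ltac:(lra) e0.
exists K0 => K N q leK leN leq; apply: le_trans (K0P _ leK).
have C0 : 0 <= C by apply: le_trans (CP 0%N); rewrite mulr_ge0 // exprn_ge0 ?ltW.
have GE M : (cpoly (G M)).[q] = \sum_(0 <= i < M.+1) (g i)%:C * q ^+ i.
  rewrite (horner_coef_wide (n := M.+1)).
    by rewrite big_mkord; apply: eq_bigr => i _; rewrite coef_map coef_poly ltn_ord.
  by rewrite size_map_poly size_poly.
rewrite !GE (@big_cat_nat _ _ _ K.+1 0 N.+1) //= addrAC subrr add0r.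
apply: le_trans (nc_sum _ _ _) _.
apply: (@le_trans _ _ (\sum_(K.+1 <= i < N.+1) C * x ^+ i)).
  apply: ler_sum => i _; rewrite ncM ncX nc_realN.
  have -> : C * x ^+ i = C / t ^+ i * s ^+ i by rewrite /x expr_div_n; ring.
  apply: ler_pM => //; rewrite ?exprn_ge0 ?nc_ge0 //.
    by rewrite ler_pdivlMr ?exprn_gt0.
  by rewrite lerXn2r // nnegrE ?nc_ge0 //; lra.
rewrite -mulr_sumr -mulrA ler_wpM2l //.
rewrite -{1}[K.+1]addn0 addnC big_addn subSS.
under eq_bigr do rewrite exprD.
rewrite -mulr_suml big_mkord exprS.
have := geom_sum_le (N - K) (x := x) ltac:(lra); have := exprn_ge0 K (ltW x0).
move: (\sum_(_ < _) _) (x ^+ K) => S y y0 SP.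
apply: le_trans (_ : (1 - x)^-1 * (x * y) <= _).
  by rewrite ler_wpM2r // mulr_ge0 // ltW.
rewrite ler_wpM2l ?invr_ge0 ?subr_ge0 ?(ltW x1) //.
by rewrite -[leRHS]mul1r ler_wpM2r // ltW.
Qed.

(** The threshold supplied by [G_Im] depends on the point; comparison with a later truncation makes
    it uniform on |q| <= s at the cost of [e]. The factor Im q covers both half planes, the lower
    one by conjugation. *)
Lemma G_Im_approx s e : 0 < s < 1 -> 0 < e -> exists K0, forall K (q : R[i]),
  (K0 <= K)%N -> nc q <= s -> - (`|Im q| * e) <= Im q * Im (cpoly (G K)).[q].
Proof.
move=> s01 e0; have [K0 K0P] := growth_tail s01 e0; exists K0 => K q leK leq.
have main (x : R[i]) : nc x <= s -> 0 < Im x -> - e <= Im (cpoly (G K)).[x].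
  move=> lex x0; have [|N0 N0P] := @G_Im x _ x0; first lra.
  have := N0P _ (leq_maxr K N0); have := K0P K (maxn K N0) x leK (leq_maxl _ _) lex.
  move: (cpoly _).[x] (cpoly _).[x] => u v /(le_trans (nc_Im _)).
  by case: u v => [u1 u2] [v1 v2] /=; rewrite ler_norml => /andP[]; lra.
have [q0|q0|->] := ltrgt0P (Im q); last by rewrite !mul0r oppr0.
  by have := main q leq q0; nra.
have := main q^* _ _; rewrite horner_conj.
case: (q) (cpoly _).[q] q0 leq => [x y] [u v] /= y0 leq /(_ _ _)/wrap[].
- by rewrite sqrrN.
- by rewrite oppr_gt0.
by nra.
Qed.

Definition Lam (Q : {poly R}) := \sum_(n < size Q) Q`_n * b n.

Lemma LamE n (Q : {poly R}) : (size Q <= n)%N -> Lam Q = \sum_(i < n) Q`_i * b i.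
Proof.
move=> le_n; rewrite /Lam (big_ord_widen n (fun i => Q`_i * b i)) // big_mkcond.
by apply: eq_bigr => i _; case: ltnP => // le_i; rewrite nth_default ?mul0r.
Qed.

(** By [gE] the functional sends V_k to [g k], so a Chebyshev expansion expresses [Lam] through the
    coefficients of g. *)
Lemma Lam_span (Q : {poly R}) (d : nat -> R) n :
  Q = \sum_(k < n) d k *: chebV R k.+1 -> Lam Q = \sum_(k < n) d k * g k.+1.
Proof.
move=> QE; have sQ : (size Q <= n)%N.
  rewrite QE; apply: (leq_trans (size_sum _ _ _)); apply/bigmax_leqP => k _.
  by apply: (leq_trans (size_scale_leq _ _)); have [-> _] := size_chebV R k.+1.
rewrite (LamE sQ) QE.
under eq_bigr do rewrite coef_sum mulr_suml.
rewrite exchange_big; apply: eq_bigr => k _; rewrite gE mulr_sumr.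
rewrite (big_ord_widen n (fun i => d k * ((chebV R k.+1)`_i * b i))) //.
rewrite [RHS]big_mkcond.
apply: eq_bigr => i _; rewrite coefZ mulrA; case: ltnP => // le_i.
by rewrite [_`_i]nth_default ?mulr0 ?mul0r //; have [-> _] := size_chebV R k.+1.
Qed.

(* Discrete orthogonality of the functions t^k - t^-k on the n-th roots of
   unity extracts the coefficients of G, while each term of the average is
   4 Q(2 Re t) Im t Im G(s t). *)
Lemma sine_average (Q : {poly R}) (d : nat -> R) m K s n (z : R[i]) :
  Q = \sum_(k < m) d k *: chebV R k.+1 -> (m <= K)%N -> (n = 2 * K + 1)%N ->
  n.-primitive_root z ->
  n%:R * \sum_(k < m) d k * (g k.+1 * s ^+ k.+1)
  = \sum_(j < n) 2 * Q.[2 * Re (z ^+ j)]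
      * (Im (z ^+ j) * Im (cpoly (G K)).[s%:C * z ^+ j]).
Proof.
move=> QE le_mK nE zP; have n_gt0 : (0 < n)%N by rewrite nE addn1.
have zn1 := prim_expr_order zP; have nz := nc_unity n_gt0 zn1.
have z0 : z != 0 by rewrite -nc_gt0 nz ltr01.
have z1 j : z ^+ j * (z ^+ j)^* = 1.
  by rewrite -sqr_normc nc_norm ncX nz expr1n expr1n.
have zJ j : (z ^+ j)^* = (z ^+ j)^-1.
  by apply: (mulfI (expf_neq0 j z0)); rewrite z1 mulfV ?expf_neq0.
apply: complexI; rewrite rmorphM rmorph_nat.
(* The factor -2 comes from t - 1/t = 2i Im t and D(t) - D(1/t) = 2i Im D(t) on the unit circle,
   whose product carries -4. *)
apply: (mulfI (x := -2)); first by rewrite oppr_eq0 pnatr_eq0.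
pose D (x : R[i]) := (cpoly (G K)).[s%:C * x].
transitivity (\sum_(j < n) (cpoly Q).[z ^+ j + z ^- j] * (z ^+ j - z ^- j)
    * (D (z ^+ j) - D (z ^- j))); last first.
  rewrite rmorph_sum mulr_sumr; apply: eq_bigr => j _; rewrite -zJ /D.
  have -> : s%:C * (z ^+ j)^* = (s%:C * z ^+ j)^*.
    by rewrite rmorphM; congr (_ * _); rewrite /= oppr0.
  rewrite horner_conj; move: (cpoly (G K)).[s%:C * _] => [u v]; case: (z ^+ j) => x y.
  have -> : x +i* y + (x +i* y)^* = (2 * x)%:C by rewrite mulr2n mulrDl mul1r; simpc.
  rewrite horner_real /=; simpc; congr (_ +i* _); ring.
have DE x : D x = \sum_(l < K.+1) (g l * s ^+ l)%:C * x ^+ l.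
  rewrite /D (horner_coef_wide (n := K.+1)) ?size_map_poly ?size_poly //.
  apply: eq_bigr => l _; rewrite coef_map coef_poly ltn_ord exprMn.
  by rewrite rmorphM rmorphXn mulrA.
have E j : (cpoly Q).[z ^+ j + z ^- j] * (z ^+ j - z ^- j) * (D (z ^+ j) - D (z ^- j))
   = \sum_(k < m) \sum_(l < K.+1) (d k * (g l * s ^+ l))%:C *
      ((z ^+ (k.+1 + l)) ^+ j - (z ^+ k.+1 / z ^+ l) ^+ j
       - (z ^+ l / z ^+ k.+1) ^+ j + (z ^- (k.+1 + l)) ^+ j).
  rewrite QE rmorph_sum /= horner_sum !mulr_suml; apply: eq_bigr => k _.
  rewrite linearZ /= hornerZ -[X in X * _]mulrA chebV_horner ?expf_neq0 // !DE -sumrB.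
  rewrite mulr_sumr; apply: eq_bigr => l _.
  rewrite [in RHS]rmorphM /= !exprMn !exprVn -!exprM ![(_ * j)%N]mulnC !exprM.
  rewrite !exprD; field.
  by rewrite !expf_neq0.
under [RHS]eq_bigr do rewrite E.
rewrite exchange_big /= rmorph_sum !mulr_sumr; apply: eq_bigr => k _.
rewrite exchange_big /=.
have lt_k : (k.+1 < K.+1)%N by rewrite ltnS (leq_trans (ltn_ord k)).
(* All exponents that occur are at most 2K < n in absolute value, so none wraps around modulo n:
   only l = k + 1 survives, with two contributions of -n. *)
have ze (i j : nat) : (z ^+ i / z ^+ j) ^+ n = 1.
  by rewrite exprMn exprVn -!exprM ![(_ * n)%N]mulnC !exprM zn1 !expr1n divr1.
have zx (i j : nat) : (i <= K)%N -> (j <= K)%N -> (z ^+ i / z ^+ j == 1) = (i == j).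
  move=> iK jK; rewrite -(inj_eq (mulIf (expf_neq0 j z0))) divfK ?expf_neq0 //.
  rewrite mul1r (eq_prim_root_expr zP) !modn_small // nE addn1 ltnS mul2n -addnn.
    exact: leq_trans jK (leq_addl K K).
  exact: leq_trans iK (leq_addl K K).
have zy (l : nat) : (l <= K)%N -> z ^+ (k.+1 + l) != 1.
  move=> lK; rewrite -(prim_order_dvd zP) gtnNdvd ?addSn // nE addn1 ltnS mul2n -addnn.
  by rewrite -addSn leq_add.
have sumE (l : nat) : (l <= K)%N -> \sum_(j < n) (d k * (g l * s ^+ l))%:C *
      ((z ^+ (k.+1 + l)) ^+ j - (z ^+ k.+1 / z ^+ l) ^+ j
       - (z ^+ l / z ^+ k.+1) ^+ j + (z ^- (k.+1 + l)) ^+ j)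
   = (d k * (g l * s ^+ l))%:C * (if l == k.+1 then - 2 * n%:R else 0).
  move=> lK; rewrite -mulr_sumr; congr (_ * _).
  rewrite big_split sumrB sumrB /= !sum_expr_unity ?ze //; first last.
  - by rewrite -exprM mulnC exprM zn1 expr1n.
  - by rewrite exprVn -exprM mulnC exprM zn1 expr1n invr1.
  rewrite invr_eq1 (negPf (zy _ lK)) !zx // eq_sym; case: eqP => _; ring.
rewrite (bigD1 (Ordinal lt_k)) //= [X in _ + X]big1 => [|l ne_l].
  rewrite sumE // eqxx addr0; ring.
rewrite sumE; last by rewrite -ltnS ltn_ord.
by rewrite ifN ?mulr0 //; apply: contraNneq ne_l => e; apply/eqP; apply: val_inj.
Qed.

(** [Lam Q] is S(1), where S(s) damps the terms by powers of s. For s < 1 the average over roots of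
    unity shows that S(s) is nonnegative up to an arbitrary error; continuity then gives s = 1. *)
Lemma Lam_ge0 (Q : {poly R}) : (forall t, 0 <= Q.[t]) -> 0 <= Lam Q.
Proof.
move=> Q0; have [d dP] := chebV_span Q; set m := size Q in dP.
rewrite (Lam_span dP).
pose S := \sum_(k < m) (d k * g k.+1) *: 'X^(k.+1).
have SE s : S.[s] = \sum_(k < m) d k * (g k.+1 * s ^+ k.+1).
  by rewrite horner_sum; apply: eq_bigr => k _; rewrite hornerZ hornerXn mulrA.
have -> : \sum_(k < m) d k * g k.+1 = S.[1].
  by rewrite SE; apply: eq_bigr => k _; rewrite expr1n mulr1.
apply: poly_ge0_at1 => s s01; apply/ler_addgt0Pr => e e0.
(* [M] bounds |Q| on [-2, 2], which contains 2 Re x; the tolerance e / (2 (M + 1)) then costs each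
   term of the average at most e. *)
pose M := wnorm 2 (cpoly Q); have M0 : 0 <= M by rewrite wnorm_ge0.
have e1 : 0 < e / (2 * (M + 1)) by rewrite divr_gt0 // mulr_gt0 //; lra.
have [K0 K0P] := G_Im_approx s01 e1.
pose K := maxn K0 m; pose n := (2 * K + 1)%N.
have n_gt0 : (0 < n)%N by rewrite /n addn1.
have [z zP] := complex_prim_root_exists R n_gt0.
have nz := nc_unity n_gt0 (prim_expr_order zP).
have nR : 0 < n%:R :> R by rewrite ltr0n.
rewrite -(ler_pM2l nR) mulr0 mulrDr SE.
rewrite (@sine_average Q d m K s n z) ?leq_maxr //.
have -> : n%:R * e = \sum_(j < n) e by rewrite sumr_const card_ord mulr_natl.
rewrite -big_split /=.
apply: sumr_ge0 => j _; set x := z ^+ j.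
have nx : nc x = 1 by rewrite /x ncX nz expr1n.
have := K0P K (s%:C * x) (leq_maxl _ _).
rewrite ncM nx nc_real ?mulr1 ?lexx; last by lra.
have -> : Im (s%:C * x) = s * Im x by case: (x) => u v /=; ring.
set I := Im _.[_] => /(_ isT).
have ix : `|Im x| <= 1 by rewrite -nx nc_Im.
have rx : `|Re x| <= 1 by rewrite -nx nc_Re.
have := Q0 (2 * Re x); have : Q.[2 * Re x] <= M.
  apply: le_trans (ler_norm _) _; rewrite -nc_realN -horner_real.
  apply: le_trans (nc_horner _ _) (wnorm_le _ (nc_ge0 _) _).
  by rewrite nc_realN normrM normr_nat; lra.
move: (Q.[_]) => y yM y0; rewrite normrM gtr0_norm; last by lra.
rewrite -!mulrA -mulrN ler_pM2l; last by lra.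
move=> leI.
have H : `|Im x| * (e / (2 * (M + 1))) <= e / (2 * (M + 1)).
  by rewrite -[leRHS]mul1r ler_wpM2r // ltW.
have H2 : - (e / (2 * (M + 1))) <= Im x * I by lra.
have H3 : e / (2 * (M + 1)) * (M + 1) * 2 = e by field; apply: lt0r_neq0; lra.
move: (e / _) e1 H3 H2 {leI H} => w w0 <- H; move: (Im x * I) H => v H.
nra.
Qed.
End TypicallyReal.

(** * Congruence of polynomials modulo powers of X *)

Section Congruences.
Variable R : comNzRingType.
Implicit Types (p q f : {poly R}).

Definition eqmodXn n p q := forall i, (i < n)%N -> p`_i = q`_i.

Lemma eqmodXn_trans n q p f : eqmodXn n p q -> eqmodXn n q f -> eqmodXn n p f.
Proof. by move=> pq qf i lt_in; rewrite pq // qf. Qed.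

Lemma eqmodXnM n p p' q q' :
  eqmodXn n p p' -> eqmodXn n q q' -> eqmodXn n (p * q) (p' * q').
Proof.
move=> pp' qq' i lt_in; rewrite !coefM; apply: eq_bigr => j _.
by rewrite pp' ?qq' // (leq_ltn_trans _ lt_in) ?leq_subr // -ltnS.
Qed.

Lemma eqmodXn_exp n p q j : eqmodXn n p q -> eqmodXn n (p ^+ j) (q ^+ j).
Proof.
by move=> pq; elim: j => [|j IH]; rewrite ?expr0 // !exprS; apply: eqmodXnM.
Qed.

Lemma coef_exp_small f i k : f`_0 = 0 -> (k < i)%N -> (f ^+ i)`_k = 0.
Proof.
move=> f0; elim: i k => // i IH k lt_ki; rewrite exprS coefM big1 // => -[[|j] lt_j] _ /=.
  by rewrite f0 mul0r.
by rewrite IH ?mulr0 //; lia.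
Qed.

(** As [f] has no constant term, f^i starts in degree i or later, so the range of the sum depends on
    [k] and not on the size of [p]. *)
Lemma coef_comp_small p f k : f`_0 = 0 ->
  (p \Po f)`_k = \sum_(i < k.+1) p`_i * (f ^+ i)`_k.
Proof.
move=> f0; rewrite comp_polyE coef_sum.
pose M := maxn (size p) k.+1.
have H m : (m <= M)%N -> (forall i, (m <= i)%N -> (p`_i * (f ^+ i)`_k = 0)) ->
   \sum_(i < m) (p`_i * (f ^+ i)`_k) = \sum_(i < M) (p`_i * (f ^+ i)`_k).
  move=> le_m zero; rewrite (big_ord_widen M (fun i => p`_i * (f ^+ i)`_k)) //.
  by rewrite big_mkcond; apply: eq_bigr => i _; case: ltnP => // /zero.
under eq_bigr do rewrite coefZ.
rewrite !H ?leq_maxl ?leq_maxr // => i le_i.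
  by rewrite nth_default ?mul0r.
by rewrite coef_exp_small ?mulr0.
Qed.

Lemma eqmodXn_compl n p q f : f`_0 = 0 -> eqmodXn n p q ->
  eqmodXn n (p \Po f) (q \Po f).
Proof.
move=> f0 pq k lt_kn; rewrite !coef_comp_small //; apply: eq_bigr => i _.
by rewrite pq // (leq_ltn_trans _ lt_kn) // -ltnS.
Qed.

Lemma eqmodXn_compr n p f f' : eqmodXn n f f' -> eqmodXn n (p \Po f) (p \Po f').
Proof.
move=> ff' k lt_kn; rewrite !comp_polyE !coef_sum; apply: eq_bigr => i _.
by rewrite !coefZ (eqmodXn_exp _ ff').
Qed.
End Congruences.

(** * The formal inverse series and the Joukowski substitution *)

Section FormalInverse.
Variables (R : realType) (r : nat) (a : nat -> R) (kappa : R).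

Definition realP : {poly R} := 'X - \sum_(2 <= j < r.+1) a j *: 'X^j.

(* The coefficients of the inverse series of P / kappa. *)
Definition bseq n := kappa ^+ n.+1 * c_seq r a n.

Definition invF N := \poly_(i < N.+1) (if i is n.+1 then bseq n else 0).

Lemma invF0 N : (invF N)`_0 = 0.
Proof. by rewrite coef_poly. Qed.

(** This identifies the inner sum of the recurrence: X^j is factored out and the remaining power is
    multiplied out. The factors kappa^(u_i + 1) combine to kappa^(n + 1). *)
Lemma coef_invF_exp N n j : (0 < n)%N -> (n < N)%N -> (1 < j)%N ->
  (invF N ^+ j)`_n.+1 = kappa ^+ n.+1 *
    \sum_(u : {ffun 'I_j -> 'I_n} | (\sum_i u i + j == n + 1)%N)
       \prod_i c_seq r a (u i).
Proof.
move=> n0 lt_nN j1; pose f := \poly_(i < N) bseq i.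
(* Since j >= 2, only coefficients below n contribute; cutting the series at n makes its j-th power
   expand over exactly the functions of the recurrence. *)
pose h := \sum_(u < n) bseq u *: 'X^u.
have -> : invF N = 'X * f.
  by apply/polyP => -[|i]; rewrite coefXM !coef_poly.
have fh : eqmodXn n f h.
  move=> i lt_in; rewrite coef_poly (ltn_trans lt_in lt_nN) coef_sum.
  rewrite (bigD1 (Ordinal lt_in)) //= coefZ coefXn eqxx mulr1 big1 ?addr0 //.
  move=> u ne_ui; rewrite coefZ coefXn; case: eqP => [e|_]; last by rewrite mulr0.
  by case/eqP: ne_ui; apply: val_inj.
rewrite exprMn coefXnM; case: ltnP => [lt_j|le_j].
  rewrite big_pred0 ?mulr0 // => u; apply/eqP; rewrite addn1 => e.
  by move: lt_j; rewrite -e ltnNge leq_addl.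
rewrite (eqmodXn_exp _ fh); last by lia.
have -> : h ^+ j = \prod_(i < j) h by rewrite prodr_const card_ord.
rewrite /h bigA_distr_bigA /= coef_sum mulr_sumr [RHS]big_mkcond /=.
apply: eq_bigr => u _.
have -> : \prod_(i < j) (bseq (u i) *: 'X^(u i))
    = (\prod_(i < j) bseq (u i)) *: 'X^(\sum_i u i).
  elim/big_rec3: _ => [|i x y z _ ->]; first by rewrite scale1r.
  by rewrite exprD -scalerAl -scalerAr scalerA.
rewrite coefZ coefXn /bseq big_split /= prodrXr.
have -> : (n.+1 - j == \sum_i u i)%N = (\sum_i u i + j == n + 1)%N by lia.
case: eqP => [e|_]; last by rewrite mulr0.
rewrite mulr1; congr (_ ^+ _ * _).
under eq_bigr do rewrite -addn1.
by rewrite big_split /= sum_nat_const card_ord muln1 e addn1.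
Qed.

(** Degree 1 expresses c_0 = 1; in each degree n + 1 >= 2 the congruence is the recurrence for
    c_n. *)
Lemma realP_invF N : eqmodXn N.+1 (realP \Po invF N) (kappa *: 'X).
Proof.
move=> k lt_k; rewrite rmorphB rmorph_sum /= comp_polyX coefB coef_sum.
under eq_bigr => j _ do rewrite comp_polyZ comp_Xn_poly coefZ.
rewrite coefZ coefX [(invF N)`_k]coef_poly lt_k.
case: k lt_k => [|[|n]] lt_k.
- rewrite big_nat big1 ?subrr ?mulr0 // => j j2.
  by rewrite coef_exp_small ?mulr0 ?invF0 //; lia.
- rewrite big_nat big1 => [|j j2]; last by rewrite coef_exp_small ?mulr0 ?invF0 //; lia.
  by rewrite subr0 /bseq c_seq0 expr1.
rewrite mulr0 /bseq c_seqE // mulr_sumr; apply/eqP; rewrite subr_eq0; apply/eqP.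
apply: eq_big_nat => j /andP[j2 _]; rewrite coef_invF_exp //.
by rewrite mulrCA.
Qed.

(* q / (1 + q^2) = q - q^3 + q^5 - ... *)
Definition joukowski_coef i : R := if odd i then (-1) ^+ i./2 else 0.
Definition joukowski N := \poly_(i < N.+1) joukowski_coef i.

Lemma joukowski0 N : (joukowski N)`_0 = 0.
Proof. by rewrite coef_poly. Qed.

Lemma joukowskiP N : eqmodXn N.+1 ((1 + 'X^2) * joukowski N) 'X.
Proof.
move=> k lt_k; rewrite mulrDl mul1r coefD coefXnM coefX !coef_poly lt_k.
case: k lt_k => [|[|k]] lt_k; rewrite ?addr0 //=.
rewrite subn2 /= ifT; last by lia.
rewrite /joukowski_coef /=.
rewrite negbK; case: ifP => _; last by rewrite addr0.
by rewrite exprS mulN1r addNr.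
Qed.

(** With J = q / (1 + q^2), the identity (1 + q^2) J^(n+1) = q J^n is the three-term recurrence of
    the V_k read on coefficients. It amounts to expanding the generating function q / (1 - t q +
    q^2) of the V_k(t) in powers of t. *)
Lemma joukowski_chebV N k n : (k <= N)%N -> (joukowski N ^+ n.+1)`_k = (chebV R k)`_n.
Proof.
elim/nat_ind2: k n => [||k IH1 IH2] n le_k.
- by rewrite chebV0 coef0 coef_exp_small ?joukowski0.
- rewrite chebV1 coefC; case: n => [|n]; last by rewrite coef_exp_small ?joukowski0.
  by rewrite expr1 coef_poly ltnS le_k.
rewrite chebVSS coefB coefXM -IH1; last by lia.
have : ((1 + 'X^2) * joukowski N ^+ n.+1)`_k.+2 = ('X * joukowski N ^+ n)`_k.+2.
  rewrite [joukowski N ^+ n.+1]exprS mulrA; apply: (@eqmodXnM _ N.+1) => //; exact: joukowskiP.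
rewrite mulrDl mul1r coefD coefXnM coefXM subn2 /= IH1; last by lia.
move/(canRL (addrK _)) ->; congr (_ - _).
case: n => [|n] /=; first by rewrite coefC.
by rewrite IH2 //; lia.
Qed.

(** The coefficient of q^k in f(kappa q / (1 + q^2)); truncating both series at degree k already
    gives its exact value. *)
Definition gseq k := (invF k \Po joukowski k)`_k.
Definition gpoly N := \poly_(i < N.+1) gseq i.

Lemma gseq_chebV k : gseq k = \sum_(n < k) (chebV R k)`_n * bseq n.
Proof.
rewrite /gseq coef_comp_small ?joukowski0 // big_ord_recl invF0 mul0r add0r.
apply: eq_bigr => n _; rewrite lift0 joukowski_chebV // mulrC coef_poly ifT //.
by rewrite ltnS.
Qed.

Lemma eqmodXn_poly (E : nat -> R) M N : (M <= N)%N ->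
  eqmodXn M.+1 (\poly_(i < M.+1) E i) (\poly_(i < N.+1) E i).
Proof. by move=> le_MN k lt_k; rewrite !coef_poly lt_k (leq_trans lt_k). Qed.

Lemma gpolyP N : eqmodXn N.+1 (gpoly N) (invF N \Po joukowski N).
Proof.
move=> k lt_k; rewrite coef_poly lt_k /gseq.
apply: (@eqmodXn_trans _ k.+1 (invF N \Po joukowski k)) => //.
  by apply: eqmodXn_compl; [exact: joukowski0 | exact: eqmodXn_poly].
by apply: eqmodXn_compr; exact: eqmodXn_poly.
Qed.

Lemma realP_gpoly N : eqmodXn N.+1 (realP \Po gpoly N) (kappa *: joukowski N).
Proof.
apply: eqmodXn_trans (eqmodXn_compr _ (@gpolyP N)) _.
rewrite comp_polyA -[X in eqmodXn _ _ (_ *: X)](comp_polyX (joukowski N)) -comp_polyZ.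
by apply: eqmodXn_compl; [exact: joukowski0 | exact: realP_invF].
Qed.

Lemma gseq0 : gseq 0 = 0.
Proof. by rewrite gseq_chebV big_ord0. Qed.

Lemma gseq1 : gseq 1 = kappa.
Proof. by rewrite gseq_chebV big_ord1 chebV1 coefC mul1r /bseq c_seq0 mulr1. Qed.
End FormalInverse.

(** * Taylor expansion and an implicit function bound *)

Section ComplexPolynomials.
Variable R : rcfType.
Implicit Types (p q P h y t : {poly R[i]}) (s : R) (w c x : R[i]).

(** Vanishing constant terms gain one order: in the coefficient of degree n, the top coefficient of
    either factor is multiplied by 0. *)
Lemma eqmodXnM_S n p p' q q' : p`_0 = 0 -> p'`_0 = 0 -> q`_0 = 0 -> q'`_0 = 0 ->
  eqmodXn n p p' -> eqmodXn n q q' -> eqmodXn n.+1 (p * q) (p' * q').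
Proof.
move=> p0 p'0 q0 q'0 pp' qq' i lt_in; rewrite !coefM; apply: eq_bigr => j _.
have [->|j0] := eqVneq (j : nat) 0%N; first by rewrite p0 p'0 !mul0r.
have [e|ji] := eqVneq (j : nat) i; first by rewrite e subnn q0 q'0 !mulr0.
have := ltn_ord j => ltj; rewrite pp' ?qq' //; lia.
Qed.

Lemma wnorm_take_eqmodXn s n p q : eqmodXn n p q ->
  wnorm s (take_poly n p) = wnorm s (take_poly n q).
Proof.
move=> pq; congr wnorm; apply/polyP => i; rewrite !coef_take_poly.
by case: ifP => // /pq.
Qed.

Lemma wnorm_sub0 s p : 0 <= s -> wnorm s (p - (p`_0)%:P) <= wnorm s p.
Proof.
move=> s0; rewrite (wnormE (n := size p)); last first.
  apply/leq_sizeP => j le_j; rewrite coefB coefC [p`_j]nth_default // sub0r.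
  case: eqP le_j => [->|_ _]; rewrite ?oppr0 //.
  by rewrite leqn0 size_poly_eq0 => /eqP ->; rewrite coef0 oppr0.
apply: ler_sum => i _; rewrite coefB coefC; case: eqP => [->|_]; rewrite ?subr0 //.
by rewrite subrr nc0 mul0r mulr_ge0 ?nc_ge0 ?exprn_ge0.
Qed.

Lemma wnorm_drop_poly s n p : 0 <= s ->
  s ^+ n * wnorm s (drop_poly n p) <= wnorm s p.
Proof.
move=> s0; rewrite -wnormXnM.
have sz : (size ('X^n * drop_poly n p)%R <= maxn (size p) n)%N.
  apply/leq_sizeP => j; rewrite geq_max => /andP[pj nj].
  by rewrite coefXnM ltnNge nj /= coef_drop_poly subnK // nth_default.
rewrite (wnormE _ sz) (wnormE (n := maxn (size p) n)) ?leq_maxl //.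
apply: ler_sum => i _; rewrite coefXnM; case: ltnP => [_|le_n].
  by rewrite nc0 mul0r mulr_ge0 ?nc_ge0 ?exprn_ge0.
by rewrite coef_drop_poly subnK.
Qed.

(** In degrees i <= n the ratio (s/t)^i is at most (1 + s/t)^n, whichever radius is larger. *)
Lemma wnorm_take_change s (t : R) n p : 0 <= s -> 0 < t ->
  wnorm s (take_poly n.+1 p) <= (1 + s / t) ^+ n * wnorm t p.
Proof.
move=> s0 t0; rewrite (wnormE (n := n.+1)) ?size_take_poly //.
have st : 0 <= s / t by rewrite divr_ge0 // ltW.
apply: (@le_trans _ _ ((1 + s / t) ^+ n * wnorm t (take_poly n.+1 p))); last first.
  by rewrite ler_wpM2l ?exprn_ge0 ?wnorm_take_le ?addr_ge0 // ltW.
rewrite (wnormE (n := n.+1)) ?size_take_poly // mulr_sumr; apply: ler_sum => i _.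
rewrite mulrCA ler_wpM2l ?nc_ge0 //.
have -> : s ^+ i = (s / t) ^+ i * t ^+ i by rewrite -exprMn divfK // gt_eqF.
rewrite ler_wpM2r ?exprn_ge0 ?(ltW t0) //.
apply: (@le_trans _ _ ((1 + s / t) ^+ i)); first by rewrite lerXn2r ?nnegrE //; lra.
by rewrite ler_weXn2l //; [lra | rewrite -ltnS].
Qed.

Lemma coef_shift p c k : (p \Po ('X + c%:P))`_k = p^`N(k).[c].
Proof.
rewrite /comp_poly addrC nderiv_taylor; last exact: mulrC.
under eq_bigr do rewrite nderivn_map horner_map mul_polyC.
rewrite size_map_polyC coef_sum.
case: (ltnP k (size p)) => [lt_k|le_k].
  rewrite (bigD1 (Ordinal lt_k)) //= coefZ coefXn eqxx mulr1 big1 ?addr0 // => i ne_ik.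
  rewrite coefZ coefXn; case: eqP => [e|_]; last by rewrite mulr0.
  by case/eqP: ne_ik; apply: val_inj.
rewrite nderivn_poly0 // horner0 big1 // => i _; rewrite coefZ coefXn.
by rewrite gtn_eqF ?mulr0 // (leq_trans (ltn_ord i)).
Qed.

(** A Lipschitz bound: after recentring at [w], the difference is x times a polynomial whose norm at
    radius 1 is controlled by [P] at radius 1 + |w|. *)
Lemma nc_horner_sub P w x : nc x <= 1 ->
  nc (P.[w + x] - P.[w]) <= nc x * wnorm (1 + nc w) P.
Proof.
move=> x1; pose p := P \Po ('X + w%:P).
have E (y : R[i]) : P.[w + y] = p.[y] by rewrite horner_comp !hornerE addrC.
rewrite -{2}[w]addr0 !E -[p](poly_take_drop 1).
have -> : take_poly 1 p = (p`_0)%:P.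
  by apply/polyP => -[|i]; rewrite coef_take_poly coefC.
rewrite !hornerE addrAC subrr add0r mulrC ncM.
rewrite ler_wpM2l ?nc_ge0 //; apply: le_trans (nc_horner _ _) _.
apply: le_trans (wnorm_le _ (nc_ge0 x) x1) _.
have := wnorm_drop_poly 1 p ler01; rewrite expr1 mul1r => /le_trans; apply.
by rewrite /p wnorm_shift.
Qed.

(* The Taylor coefficients of h are determined recursively by those of P o h,
   so the bound propagates from one truncation to the next. *)
Lemma implicit_bound P h (s beta lam : R) n : 0 <= s -> 0 <= beta <= 1 -> 0 < lam ->
  lam <= nc P^`().[h`_0] -> wnorm (1 + nc h`_0) P * beta <= lam / 2 ->
  wnorm s (take_poly n.+1 (P \Po h - ((P \Po h)`_0)%:P)) <= lam * beta / 2 ->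
  wnorm s (take_poly n.+1 (h - (h`_0)%:P)) <= beta.
Proof.
move=> s0 /andP[b0 b1] lam0 le_lam le_beta le_T.
pose p := P \Po ('X + (h`_0)%:P); pose y := h - (h`_0)%:P.
have y0 : y`_0 = 0 by rewrite coefB coefC subrr.
pose d := drop_poly 2 p.
have p1 : p`_1 = P^`().[h`_0].
  have -> : p`_1 = p^`().[0] by rewrite horner_coef0 coef_deriv.
  by rewrite deriv_comp derivD derivX derivC addr0 mulr1 horner_comp !hornerE.
(* Taylor expansion of P at the constant term of h, with [d] collecting the orders from 2 on; the
   equation is then solved for the linear term. *)
have PhE : P \Po h = (p`_0)%:P + p`_1 *: y + y * (y * (d \Po y)).
  have -> : P \Po h = p \Po y.
    by rewrite -comp_polyA comp_polyD comp_polyX comp_polyC subrK.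
  rewrite -{1}[p](poly_take_drop 2) -/d comp_polyD comp_polyM comp_Xn_poly.
  have -> : take_poly 2 p = (p`_0)%:P + p`_1 *: 'X.
    apply/polyP => i; rewrite coef_take_poly coefD coefC coefZ coefX.
    by case: i => [|[|i]] //=; rewrite ?mulr0 ?addr0 ?mulr1 ?add0r.
  rewrite comp_polyD comp_polyC comp_polyZ comp_polyX expr2; congr (_ + _).
  by rewrite mulrC mulrA.
have T0 : (P \Po h)`_0 = p`_0.
  by rewrite PhE !coefD coefC coefZ y0 coefM big_ord1 y0 mul0r mulr0 !addr0.
have yE : p`_1 *: y = (P \Po h - ((P \Po h)`_0)%:P) - y * (y * (d \Po y)).
  by rewrite T0 PhE; ring.
rewrite -/y; elim: n {-2}n (leqnn n) le_T => [|m IH] n.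
  rewrite leqn0 => /eqP-> _; rewrite (wnormE (n := 1)) ?size_take_poly // big_ord1.
  by rewrite coef_take_poly y0 nc0 mul0r.
rewrite leq_eqVlt => /predU1P[->|]; last by rewrite ltnS; exact: IH.
move=> le_T; pose t := take_poly m.+1 y.
have Yt : wnorm s t <= beta.
  apply: IH => //; apply: le_trans le_T.
  have -> : take_poly m.+1 (P \Po h - ((P \Po h)`_0)%:P)
     = take_poly m.+1 (take_poly m.+2 (P \Po h - ((P \Po h)`_0)%:P)).
    apply/polyP => i; rewrite !coef_take_poly; case: ltnP => // lt_i.
    by rewrite (leq_trans lt_i).
  exact: wnorm_take_le.
have t0 : t`_0 = 0 by rewrite coef_take_poly y0.
have yt : eqmodXn m.+1 y t by move=> i lt_i; rewrite coef_take_poly lt_i.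
have pos : 0 < nc p`_1 by rewrite p1; apply: lt_le_trans le_lam.
rewrite -(ler_pM2l pos) -wnormZ -take_polyZ yE take_polyD.
(* As y has no constant term, the quadratic part up to degree m + 1 involves y only up to degree m,
   where the induction hypothesis applies. *)
have tt : eqmodXn m.+2 (y * (y * (d \Po y))) (t * (t * (d \Po t))).
  apply: eqmodXnM_S => //; do ?by rewrite coefM big_ord1 ?y0 ?t0 mul0r.
  by apply: eqmodXnM => //; apply: eqmodXn_compr.
apply: le_trans (wnormD _ _ s0) _.
have -> : take_poly m.+2 (- (y * (y * (d \Po y)))) = - take_poly m.+2 (y * (y * (d \Po y))).
  by apply/polyP => i; rewrite !(coefN, coef_take_poly); case: ifP; rewrite ?oppr0.
rewrite wnormN (wnorm_take_eqmodXn _ tt).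
have D1 : wnorm s (d \Po t) <= wnorm (1 + nc h`_0) P.
  apply: le_trans (wnorm_comp _ _ s0) _.
  apply: (@le_trans _ _ (wnorm 1 d)).
    by apply: wnorm_le; rewrite ?wnorm_ge0 // (le_trans Yt).
  have := wnorm_drop_poly 2 p ler01; rewrite expr1n mul1r => /le_trans; apply.
  by rewrite /p wnorm_shift.
have D2 : wnorm s (t * (t * (d \Po t))) <= beta * (beta * wnorm (1 + nc h`_0) P).
  apply: le_trans (wnormM _ _ s0) _; apply: ler_pM; rewrite ?wnorm_ge0 //.
  by apply: le_trans (wnormM _ _ s0) _; apply: ler_pM; rewrite ?wnorm_ge0.
have D3 := wnorm_take_le (t * (t * (d \Po t))) m.+2 s0.
(* The given side contributes lam beta / 2 and the quadratic part at most beta^2 Gamma <= beta lam /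
   2, with Gamma the norm of P; the sum is at most |P'(h_0)| beta. *)
rewrite p1; move: le_lam le_beta le_T D2 D3.
move: (wnorm _ (take_poly _ (t * _))) (wnorm _ (t * _)) (wnorm _ (take_poly _ _)) (wnorm _ P) (nc P^`().[_]).
move=> A B T G L; nra.
Qed.
End ComplexPolynomials.

(** * Lower bounds for polynomial values *)

Section PolynomialBounds.
Variable R : rcfType.
Implicit Types (P : {poly R[i]}) (rs : seq R[i]) (w : R[i]).

Lemma nc_prod_ge rs w (m : R) : 0 <= m -> (forall x, x \in rs -> m <= nc (w - x)) ->
  m ^+ size rs <= nc (\prod_(x <- rs) ('X - x%:P)).[w].
Proof.
move=> m0; elim: rs => [|x rs IH] le_m; first by rewrite big_nil hornerC nc1.
rewrite big_cons hornerM ncM exprS !hornerE; apply: ler_pM => //.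
- exact: exprn_ge0.
- by apply: le_m; rewrite mem_head.
- by apply: IH => y y_rs; apply: le_m; rewrite inE y_rs orbT.
Qed.

(** Beyond the sum of the moduli of the roots plus [m], every linear factor is at least m >= 1 in
    modulus, and [m] is chosen so that a single such factor times the leading coefficient exceeds
    [B]. *)
Lemma poly_proper P (B : R) : (1 < size P)%N -> 0 <= B ->
  exists W, 0 <= W /\ forall w, nc P.[w] <= B -> nc w <= W.
Proof.
move=> sP B0; have [rs PE] := closed_field_poly_normal P.
have P0 : P != 0 by rewrite -size_poly_gt0 ltnW.
have l0 : 0 < nc (lead_coef P) by rewrite nc_gt0 lead_coef_eq0.
pose m := 1 + B / nc (lead_coef P).
have Bl : 0 <= B / nc (lead_coef P) by rewrite divr_ge0 // ltW.
have m1 : 1 <= m by rewrite lerDl.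
have s0 : 0 <= \sum_(x <- rs) nc x by apply: sumr_ge0 => x _; apply: nc_ge0.
exists (\sum_(x <- rs) nc x + m); split=> [|w]; first by rewrite addr_ge0 //; lra.
apply: contraTT; rewrite -!ltNge => lt_w.
have le_m x : x \in rs -> m <= nc (w - x).
  move=> x_rs; apply: le_trans (ncBl _ _).
  have : nc x <= \sum_(y <- rs) nc y.
    by rewrite (big_rem x) //= lerDl sumr_ge0 // => y _; apply: nc_ge0.
  by lra.
have m0 : 0 <= m by apply: le_trans m1.
have le_Q := nc_prod_ge m0 le_m.
have srs : (0 < size rs)%N.
  move: sP; rewrite PE size_scale ?lead_coef_eq0 // size_prod_XsubC; lia.
have le_mm : m <= m ^+ size rs by rewrite -[leLHS]expr1 ler_weXn2l.
have le_mQ := le_trans le_mm le_Q.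
have -> : nc P.[w] = nc (lead_coef P) * nc (\prod_(x <- rs) ('X - x%:P)).[w].
  by rewrite {1}PE hornerZ ncM.
apply: (@lt_le_trans _ _ (nc (lead_coef P) * m)); last by rewrite ler_pM2l.
have -> : nc (lead_coef P) * m = nc (lead_coef P) + B.
  by rewrite /m mulrDr mulr1 [_ * (B / _)]mulrC divfK ?gt_eqF.
by rewrite ltrDr.
Qed.

(* A small value of P' at w forces w to be close to a critical point x, hence
   P(w) to be close to P(x). *)
Lemma deriv_lower P (W d : R) : P^`() != 0 -> 0 <= W -> 0 < d ->
  exists lam, 0 < lam /\ forall w, nc w <= W ->
    (forall x, root P^`() x -> d <= nc (P.[w] - P.[x])) -> lam <= nc P^`().[w].
Proof.
move=> P0 W0 d0; have [rs PE] := closed_field_poly_normal P^`().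
have l0 : 0 < nc (lead_coef P^`()) by rewrite nc_gt0 lead_coef_eq0.
pose L := wnorm (2 + W) P.
have L0 : 0 <= L by rewrite wnorm_ge0 //; lra.
pose eta := Num.min 1 (d / (2 * (L + 1))).
have e0 : 0 < eta by rewrite lt_min ltr01 divr_gt0 // mulr_gt0 //; lra.
have e1 : eta <= 1 by rewrite ge_min lexx.
have eL : eta * L < d.
  have : eta <= d / (2 * (L + 1)) by rewrite ge_min lexx orbT.
  rewrite ler_pdivlMr; last by rewrite mulr_gt0 //; lra.
  nra.
exists (nc (lead_coef P^`()) * eta ^+ size rs); split.
  by rewrite mulr_gt0 // exprn_gt0.
move=> w wW far; rewrite {2}PE hornerZ ncM ler_pM2l //.
apply: nc_prod_ge; first exact: ltW.
move=> x x_rs; rewrite leNgt; apply/negP => lt_e.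
have rx : root P^`() x by rewrite PE rootZ ?lead_coef_eq0 // root_prod_XsubC.
have := far x rx; apply/negP; rewrite -ltNge nc_subC.
have -> : P.[x] = P.[w + (x - w)] by rewrite addrC subrK.
rewrite nc_subC in lt_e.
apply: le_lt_trans (nc_horner_sub _ _ _) _; first by lra.
apply: le_lt_trans eL.
apply: ler_pM; rewrite ?nc_ge0 ?(ltW lt_e) ?wnorm_ge0 ?addr_ge0 ?nc_ge0 //.
by apply: wnorm_le; rewrite ?addr_ge0 ?nc_ge0 //; lra.
Qed.

(* k q - v (1 + q^2) = - v (q - e) (q - 1/e) with |e| = 1. *)
Lemma nc_quadratic_ge (k v s : R) (q : R[i]) : v != 0 -> 0 <= k <= 2 * `|v| ->
  nc q <= s -> s < 1 -> `|v| * (1 - s) ^+ 2 <= nc (k%:C * q - v%:C * (1 + q ^+ 2)).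
Proof.
move=> v0 /andP[k0 kv] qs s1; pose c := k / (2 * v).
have vp : 0 < `|v| by rewrite normr_gt0.
(* The bound k <= 2|v| places [c] in [-1, 1], so that both roots c + id and c - id lie on the unit
   circle. *)
have c1 : 0 <= 1 - c ^+ 2.
  rewrite subr_ge0 -real_normK ?num_real // expr_le1 // /c normf_div normrM normr_nat.
  rewrite (ger0_norm k0).
  by rewrite ler_pdivrMr ?mul1r // mulr_gt0.
pose d := Num.sqrt (1 - c ^+ 2).
have dd : d ^+ 2 = 1 - c ^+ 2 by rewrite sqr_sqrtr.
pose e : R[i] := c +i* d.
have ne : nc e = 1 by rewrite /= dd addrC subrK sqrtr1.
have nef : nc (c -i* d) = 1 by rewrite /= sqrrN dd addrC subrK sqrtr1.
have kc : k = 2 * v * c by rewrite /c; field.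
have -> : k%:C * q - v%:C * (1 + q ^+ 2) = - v%:C * ((q - e) * (q - c -i* d)).
  case: (q) => x y; rewrite expr2 /e kc; simpc; congr (_ +i* _); last by ring.
  have vd : v * d ^+ 2 = v * (1 - c ^+ 2) by rewrite dd.
  by move: d vd {dd e ne nef} => d vd; clearbody c; lra.
rewrite ncM ncN nc_realN ler_pM2l // ncM expr2.
apply: ler_pM; rewrite ?subr_ge0 ?(ltW s1) // nc_subC; apply: le_trans (ncBl _ _).
  by rewrite ne; lra.
by rewrite nef; lra.
Qed.
End PolynomialBounds.

(** * Extension of the series to the unit disc *)

Section Continuation.
Variable R : realType.
Variables (P : {poly R[i]}) (kappa : R) (g : nat -> R).
Let G N : {poly R[i]} := \poly_(i < N.+1) (g i)%:C.
Let J N : {poly R[i]} := \poly_(i < N.+1) (joukowski_coef R i)%:C.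

Hypothesis kappa_gt0 : 0 < kappa.
Hypothesis g0 : g 0 = 0.
Hypothesis P_size : (1 < size P)%N.
Hypothesis P_deriv0 : P^`().[0] = 1.
Hypothesis PG : forall N, eqmodXn N.+1 (P \Po G N) (kappa%:C *: J N).
Hypothesis JP : forall N, eqmodXn N.+1 ((1 + 'X^2) * J N) 'X.
Hypothesis P_crit : forall x, root P^`() x ->
  exists2 v : R, P.[x] = v%:C & (v == 0) || (kappa <= 2 * `|v|).

(** Bounded terms at radius [s]: an elementary substitute for a radius of convergence of at least
    [s]. *)
Definition growth (s : R) := exists C, forall k, `|g k| * s ^+ k <= C.

(** The defects of the truncated equation, both vanishing below degree N + 1. [errF] has the
    denominator 1 + q^2 cleared and serves to locate values; [errP] serves for Taylor
    coefficients. *)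
Let errP N := P \Po G N - kappa%:C *: J N.
Let errF N := (1 + 'X^2) * (P \Po G N) - kappa%:C *: 'X.

Lemma errP0 N i : (i < N.+1)%N -> (errP N)`_i = 0.
Proof. by move=> lt_i; rewrite coefB PG ?subrr. Qed.

Lemma errF0 N i : (i < N.+1)%N -> (errF N)`_i = 0.
Proof.
move=> lt_i; rewrite coefB coefZ -(JP lt_i) -coefZ scalerAr.
have H : eqmodXn N.+1 ((1 + 'X^2) * (P \Po G N)) ((1 + 'X^2) * (kappa%:C *: J N)).
  by apply: eqmodXnM => //; exact: PG.
by rewrite H ?subrr.
Qed.

Lemma growth_le s t : 0 <= s -> s <= t -> growth t -> growth s.
Proof.
move=> s0 st [C CP]; exists C => k; apply: le_trans (CP k).
by rewrite ler_wpM2l // lerXn2r // nnegrE (le_trans s0).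
Qed.

Lemma wnorm_J s N : 0 <= s < 1 -> wnorm s (J N) <= (1 - s)^-1.
Proof.
move=> s01; apply: le_trans (geom_sum_le N.+1 s01).
rewrite (wnormE (n := N.+1)) ?size_poly //; apply: ler_sum => i _.
rewrite coef_poly ltn_ord nc_realN -[leRHS]mul1r ler_wpM2r ?exprn_ge0 //.
  by case/andP: s01.
by rewrite /joukowski_coef; case: ifP; rewrite ?normr0 // normrX normrN1 expr1n.
Qed.

Lemma wnorm_G s t : 0 <= s -> s < t -> growth t ->
  exists A, 0 <= A /\ forall N, wnorm s (G N) <= A.
Proof.
move=> s0 st [C CP]; have t0 : 0 < t by lra.
have x01 : 0 <= s / t < 1 by rewrite divr_ge0 ?(ltW t0) //= ltr_pdivrMr // mul1r.
have C0 : 0 <= C by apply: le_trans (CP 0%N); rewrite mulr_ge0 ?exprn_ge0 // ltW.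
exists (C * (1 - s / t)^-1); split.
  by rewrite mulr_ge0 // invr_ge0 subr_ge0 ltW //; case/andP: x01.
move=> N; apply: (@le_trans _ _ (C * \sum_(i < N.+1) (s / t) ^+ i)); last first.
  by rewrite ler_wpM2l // geom_sum_le.
rewrite (wnormE (n := N.+1)) ?size_poly // mulr_sumr; apply: ler_sum => i _.
rewrite coef_poly ltn_ord nc_realN expr_div_n mulrCA mulrC.
rewrite ler_wpM2l ?exprn_ge0 // ler_pdivlMr ?exprn_gt0 //.
Qed.

(** Uniform boundedness at radius [t] and vanishing to order N + 1 give decay like (s/t)^(N+1) at
    radius [s]. *)
Lemma small_of_drop (Q : nat -> {poly R[i]}) s t B : 0 <= s -> s < t -> 0 <= B ->
  (forall N i, (i < N.+1)%N -> (Q N)`_i = 0) -> (forall N, wnorm t (Q N) <= B) ->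
  forall e, 0 < e -> exists N0, forall N, (N0 <= N)%N -> wnorm s (Q N) <= e.
Proof.
move=> s0 st B0 Q0 QB e e0; have t0 : 0 < t by lra.
have x01 : 0 <= s / t < 1 by rewrite divr_ge0 ?(ltW t0) //= ltr_pdivrMr // mul1r.
have [N0 N0P] := geom_small B x01 e0; exists N0 => N leN.
apply: le_trans (N0P N.+1 (leqW leN)).
have := wnorm_drop s0 (ltW st) (Q0 N).
rewrite -ler_pdivlMr ?exprn_gt0 // => /le_trans; apply.
rewrite expr_div_n mulrA [B * _]mulrC ler_pM2r ?invr_gt0 ?exprn_gt0 //.
by rewrite ler_wpM2l ?exprn_ge0.
Qed.

Lemma wnorm_PG s t : 0 <= s -> s < t -> growth t ->
  exists A, 0 <= A /\ forall N, wnorm s (P \Po G N) <= A.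
Proof.
move=> s0 st /(wnorm_G s0 st)[A [A0 AP]]; exists (wnorm A P); split.
  exact: wnorm_ge0.
move=> N; apply: le_trans (wnorm_comp _ _ s0) _.
by apply: wnorm_le; rewrite ?wnorm_ge0.
Qed.

Lemma errF_small s t e : 0 <= s -> s < t -> growth t -> 0 < e ->
  exists N0, forall N, (N0 <= N)%N -> wnorm s (errF N) <= e.
Proof.
move=> s0 st gt e0; pose u := (s + t) / 2.
have u0 : 0 <= u by rewrite /u; lra.
have [A [A0 AP]] := @wnorm_PG u t u0 ltac:(rewrite /u; lra) gt.
apply: (@small_of_drop _ s u ((1 + u ^+ 2) * A + kappa * u)) => //.
- by rewrite /u; lra.
- have u2 := exprn_ge0 2 u0; have k0 := ltW kappa_gt0.
  by apply: addr_ge0; apply: mulr_ge0 => //; apply: addr_ge0.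
- exact: errF0.
move=> N; apply: le_trans (wnormB _ _ u0) _; apply: lerD.
  apply: le_trans (wnormM _ _ u0) _; apply: ler_pM; rewrite ?wnorm_ge0 ?AP //.
  apply: le_trans (wnormD _ _ u0) _; apply: lerD.
    by rewrite -polyC1 wnormC nc1.
  by apply: le_trans (wnorm_exp _ _ u0) _; rewrite wnormX.
by rewrite wnormZ wnormX nc_real // ltW.
Qed.

Lemma errP_small s t e : 0 <= s -> s < t -> t <= 1 -> growth t -> 0 < e ->
  exists N0, forall N, (N0 <= N)%N -> wnorm s (errP N) <= e.
Proof.
move=> s0 st t1 gt e0; pose u := (s + t) / 2.
have u0 : 0 <= u by rewrite /u; lra.
have u1 : u < 1 by rewrite /u; lra.
have [A [A0 AP]] := @wnorm_PG u t u0 ltac:(rewrite /u; lra) gt.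
apply: (@small_of_drop _ s u (A + kappa * (1 - u)^-1)) => //.
- by rewrite /u; lra.
- have k0 := ltW kappa_gt0; apply: addr_ge0 => //; apply: mulr_ge0 => //.
  by rewrite invr_ge0 subr_ge0 ltW.
- exact: errP0.
move=> N; apply: le_trans (wnormB _ _ u0) _; apply: lerD => //.
rewrite wnormZ nc_real ?(ltW kappa_gt0) // ler_pM2l //.
by apply: wnorm_J; rewrite u0.
Qed.

(** At the origin P' equals 1, so the implicit bound applies there at a small radius, uniformly in
    the truncation. *)
Lemma growth_init : exists2 s, 0 < s & growth s.
Proof.
pose Gam := wnorm 1 P; have Gam0 : 0 <= Gam by apply: wnorm_ge0.
(* [beta] makes Gam beta <= 1/2. As J has no constant term, its norm at radius s is at most 4s, and
   [s] makes 4 kappa s <= beta / 2. *)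
pose beta := (2 * Gam + 1)^-1.
have b0 : 0 < beta by rewrite invr_gt0; lra.
have bE : beta * (2 * Gam + 1) = 1 by rewrite mulVf // gt_eqF //; lra.
have b1 : beta <= 1 by nra.
pose s := Num.min (1 / 2) (beta / (8 * kappa)).
have s0 : 0 < s by rewrite lt_min divr_gt0 //= divr_gt0 // mulr_gt0.
have s2 : s <= 1 / 2 by rewrite ge_min lexx.
have sk : s * (8 * kappa) <= beta by rewrite -ler_pdivlMr ?mulr_gt0 // ge_min lexx orbT.
exists s => //; exists beta => k.
have G0 : (G k)`_0 = 0 by rewrite coef_poly g0.
have J0 : (J k)`_0 = 0 by rewrite coef_poly.
have T0 : (P \Po G k)`_0 = 0 by rewrite PG // coefZ J0 mulr0.
have := @implicit_bound R P (G k) s beta 1 k (ltW s0) _ ltr01.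
rewrite G0 T0 subr0 P_deriv0 nc1 nc0 addr0 => /(_ _ (lexx _)) H.
have : wnorm s (take_poly k.+1 (G k)) <= beta.
  rewrite -[G k]subr0; apply: H; first by rewrite (ltW b0).
    by rewrite -/Gam; lra.
  rewrite ?polyC0 ?subr0 mul1r (wnorm_take_eqmodXn _ (@PG k)).
  apply: le_trans (wnorm_take_le _ _ (ltW s0)) _.
  rewrite wnormZ nc_real ?(ltW kappa_gt0) //.
  have D : wnorm s (J k) * (1 / 2) ^+ 1 <= s ^+ 1 * wnorm (1 / 2) (J k).
    apply: wnorm_drop => //; first exact: ltW.
    by case=> // _; rewrite J0.
  have := @wnorm_J (1 / 2) k ltac:(lra).
  have -> : (1 - 1 / 2)^-1 = 2 :> R by field.
  move: D; rewrite !expr1; move: (wnorm _ _) (wnorm _ _) => y x D y2.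
  have x4 : x <= 4 * s by nra.
  by have := ler_wpM2l (ltW kappa_gt0) x4; lra.
apply: le_trans; have := coef_le_wnorm (take_poly k.+1 (G k)) k (ltW s0).
by rewrite coef_take_poly ltnSn coef_poly ltnSn nc_realN.
Qed.

Section Step.
Variables (l s : R).
Hypothesis l0 : 0 < l.
Hypothesis s01 : 0 < s < 1.

(** A lower bound for |kappa q - v (1 + q^2)| on l <= |q| <= s, for every critical value v: the
    first entry serves v = 0, the second serves |v| >= kappa / 2. *)
Let d := Num.min (kappa * l) (kappa * (1 - s) ^+ 2 / 2).

Let d_gt0 : 0 < d.
Proof.
have [_ s1] := andP s01.
by rewrite lt_min mulr_gt0 //= divr_gt0 // mulr_gt0 // exprn_gt0 // subr_gt0.
Qed.

Lemma nc_1sqr (q : R[i]) : nc q <= s -> 1 - s ^+ 2 <= nc (1 + q ^+ 2) <= 2.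
Proof.
move=> qs; have q0 := nc_ge0 q; have [s0 s1] := andP s01.
have q2 : nc q ^+ 2 <= s ^+ 2 by rewrite lerXn2r // nnegrE ltW.
have s2 : s ^+ 2 <= 1 by rewrite expr_le1 ?ltW.
have := ncBl 1 (- q ^+ 2); have := ncD 1 (q ^+ 2).
by rewrite opprK ncN nc1 ncX => h1 h2; apply/andP; split; lra.
Qed.

Lemma errF_horner N (q : R[i]) :
  (1 + q ^+ 2) * P.[(G N).[q]] = kappa%:C * q + (errF N).[q].
Proof.
rewrite hornerD hornerN hornerM hornerZ hornerD hornerXn hornerX horner_comp -polyC1 hornerC.
by rewrite [RHS]addrC subrK.
Qed.

Lemma value_bound N (q : R[i]) : nc q <= s -> nc (errF N).[q] <= d / 2 ->
  nc P.[(G N).[q]] <= (kappa + d) / (1 - s ^+ 2).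
Proof.
move=> qs Fd; have [s0 s1] := andP s01; have /andP[lo _] := nc_1sqr qs.
have ss : 0 < 1 - s ^+ 2 by nra.
rewrite ler_pdivlMr // mulrC.
apply: le_trans (_ : nc (1 + q ^+ 2) * nc P.[(G N).[q]] <= _).
  by rewrite ler_wpM2r ?nc_ge0.
rewrite -ncM errF_horner; apply: le_trans (ncD _ _) _.
rewrite ncM nc_real ?(ltW kappa_gt0) //.
have : kappa * nc q <= kappa by rewrite -[leRHS]mulr1 ler_pM2l //; lra.
by have := d_gt0; lra.
Qed.

(** Half of [d] absorbs the defect, and division by |1 + q^2| <= 2 leaves d / 4. *)
Lemma value_far N (q x : R[i]) : l <= nc q -> nc q <= s -> nc (errF N).[q] <= d / 2 ->
  root P^`() x -> d / 4 <= nc (P.[(G N).[q]] - P.[x]).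
Proof.
move=> lq qs Fd /P_crit[v -> crit]; have [s0 s1] := andP s01.
have /andP[lo hi] := nc_1sqr qs.
suff le_d : d <= nc (kappa%:C * q - v%:C * (1 + q ^+ 2)).
  have E : (1 + q ^+ 2) * (P.[(G N).[q]] - v%:C)
     = (kappa%:C * q - v%:C * (1 + q ^+ 2)) - - (errF N).[q].
    by rewrite mulrBr errF_horner; ring.
  have := ncBl (kappa%:C * q - v%:C * (1 + q ^+ 2)) (- (errF N).[q]).
  rewrite -E ncM ncN; have := nc_ge0 (P.[(G N).[q]] - v%:C); nra.
have [->|v0] := eqVneq v 0.
  rewrite mul0r subr0 ncM nc_real ?(ltW kappa_gt0) //.
  by apply: (@le_trans _ _ (kappa * l)); [rewrite ge_min lexx | rewrite ler_pM2l].
rewrite (negPf v0) /= in crit.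
apply: (@le_trans _ _ (kappa * (1 - s) ^+ 2 / 2)); first by rewrite ge_min lexx orbT.
apply: (@le_trans _ _ (`|v| * (1 - s) ^+ 2)).
  by have := sqr_ge0 (1 - s); nra.
by apply: nc_quadratic_ge => //; rewrite crit ltW.
Qed.

(* The gain delta in the radius only depends on the modulus bounds l and s,
   because the critical values stay away from kappa q / (1 + q^2). *)
Lemma growth_step : exists2 delta, 0 < delta & forall r0 r1,
  l <= r0 -> r0 < r1 -> r1 <= s -> growth r1 -> growth (r0 + delta).
Proof.
have [s0 s1] := andP s01; have ss : 0 < 1 - s ^+ 2 by nra.
(* [W] bounds the values of the truncations on the annulus, by properness of P; [lam] then bounds
   |P'| from below at these values. *)
pose B := (kappa + d) / (1 - s ^+ 2).
have B0 : 0 <= B by rewrite divr_ge0 // ltW // addr_gt0.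
have [W [W0 WP]] := poly_proper P_size B0.
have P'0 : P^`() != 0.
  by apply/eqP => e; have := P_deriv0; rewrite e horner0 => /esym/eqP; rewrite oner_eq0.
have [lam [lam0 lamP]] := deriv_lower P'0 W0 (divr_gt0 d_gt0 (ltr0n _ 4)).
pose Gam := wnorm (1 + W) P; have Gam0 : 0 <= Gam by rewrite wnorm_ge0 ?addr_ge0.
pose beta := Num.min 1 (lam / (2 * (Gam + 1))).
have b0 : 0 < beta by rewrite lt_min ltr01 divr_gt0 // mulr_gt0 //; lra.
have b1 : beta <= 1 by rewrite ge_min lexx.
have bG : Gam * beta <= lam / 2.
  have : beta <= lam / (2 * (Gam + 1)) by rewrite ge_min lexx orbT.
  by rewrite ler_pdivlMr; [nra | rewrite mulr_gt0 //; lra].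
(* Discs of radius [t] about points with |q| <= s stay inside the unit disc, and kappa J is bounded
   there by [M]; [delta] brings its nonconstant part down to lam beta / 4. *)
pose t := (1 - s) / 2; have t0 : 0 < t by rewrite /t; lra.
pose M := kappa * (1 - (t + s))^-1.
have M0 : 0 <= M by rewrite mulr_ge0 ?invr_ge0 ?ltW // /t; lra.
pose delta := Num.min t (lam * beta * t / (4 * (M + 1))).
have de0 : 0 < delta by rewrite lt_min t0 divr_gt0 ?mulr_gt0 //; lra.
have det : delta <= t by rewrite ge_min lexx.
have deM : delta * M <= lam * beta / 4 * t.
  have : delta <= lam * beta * t / (4 * (M + 1)) by rewrite ge_min lexx orbT.
  by rewrite ler_pdivlMr; [nra | rewrite mulr_gt0 //; lra].
exists (delta / 2); first by rewrite divr_gt0.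
move=> r0 r1 lr r01 r1s gr; have r0p : 0 < r0 := lt_le_trans l0 lr.
pose u := (r1 - r0) / 2; have u0 : 0 < u by rewrite divr_gt0 ?subr_gt0.
(* The k-th Taylor coefficient of the truncation at q, seen as a polynomial in q, has C(n, k) g_n in
   degree n - k. It is bounded on |q| = r0, by W for k = 0 and by beta otherwise, so the Cauchy
   estimate applies. *)
have key n k : (k <= n)%N ->
    `|g n| *+ 'C(n, k) * r0 ^+ (n - k) * delta ^+ k <= beta + W.
  (* Changing the radius from [u] to [delta] costs the factor [c]; as n is fixed beforehand, [N] can
     be taken large enough to absorb it. *)
  move=> le_kn; pose c := (1 + delta / u) ^+ n.
  have c0 : 0 < c by rewrite exprn_gt0 // addr_gt0 // divr_gt0.
  have [N1 N1P] := errF_small (ltW r0p) r01 gr (divr_gt0 d_gt0 (ltr0n _ 2)).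
  have e0 : 0 < lam * beta / 4 / c by rewrite !(divr_gt0, mulr_gt0).
  have [N2 N2P] := @errP_small (u + r0) r1 _ ltac:(rewrite /u; lra)
    ltac:(rewrite /u; lra) ltac:(lra) gr e0.
  pose N := maxn n (maxn N1 N2).
  have le_N1 : (N1 <= N)%N by rewrite !leq_max leqnn orbT.
  have le_N2 : (N2 <= N)%N by rewrite !leq_max leqnn !orbT.
  have {}N1P := N1P N le_N1; have {}N2P := N2P N le_N2.
  have taylor (q : R[i]) : nc q = r0 -> nc ((G N)^`N(k).[q] * delta%:C ^+ k) <= beta + W.
    move=> qr; pose h := G N \Po ('X + q%:P).
    have h0 : h`_0 = (G N).[q] by rewrite coef_shift nderivn0.
    have Fq : nc (errF N).[q] <= d / 2.
      by apply: le_trans (nc_horner _ _) _; rewrite qr.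
    have wW : nc (h`_0) <= W by rewrite h0; apply/WP/value_bound; rewrite // qr; lra.
    have lamh : lam <= nc P^`().[h`_0].
      by apply: lamP => // x; rewrite h0; apply: value_far; rewrite // qr //; lra.
    have PhE : P \Po h = ((kappa%:C *: J N) \Po ('X + q%:P)) + (errP N \Po ('X + q%:P)).
      by rewrite -comp_polyD [_ + errP N]addrC subrK /h comp_polyA.
    pose A := (kappa%:C *: J N) \Po ('X + q%:P); pose E := errP N \Po ('X + q%:P).
    have leA : wnorm delta (A - (A`_0)%:P) <= lam * beta / 4.
      have : wnorm delta (A - (A`_0)%:P) * t ^+ 1 <= delta ^+ 1 * wnorm t (A - (A`_0)%:P).
        apply: wnorm_drop => //; first exact: ltW.
        by case=> // _; rewrite coefB coefC subrr.
      have : wnorm t (A - (A`_0)%:P) <= M.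
        apply: le_trans (wnorm_sub0 _ (ltW t0)) _.
        apply: le_trans (wnorm_shift _ _ (ltW t0)) _.
        rewrite wnormZ nc_real ?(ltW kappa_gt0) // ler_pM2l // qr.
        apply: le_trans (wnorm_le (t := t + s) _ _ _) _; [lra | lra |].
        by apply: wnorm_J; rewrite /t; lra.
      rewrite !expr1 => leM leD; rewrite -(ler_pM2r t0).
      by apply: le_trans leD (le_trans _ deM); rewrite ler_pM2l.
    have leE : wnorm delta (take_poly n.+1 (E - (E`_0)%:P)) <= lam * beta / 4.
      apply: le_trans (wnorm_take_change _ _ (ltW de0) u0) _; rewrite -/c mulrC.
      rewrite -ler_pdivlMr //; apply: le_trans N2P.
      apply: le_trans (wnorm_sub0 _ (ltW u0)) _.
      by apply: le_trans (wnorm_shift _ _ (ltW u0)) _; rewrite qr.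
    have := @implicit_bound R P h delta beta lam n (ltW de0) _ lam0 lamh _ _.
    move=> /(_ _ _ _)/wrap[]; first by rewrite (ltW b0).
    - apply: le_trans bG; rewrite ler_pM2r //; apply: wnorm_le; last by lra.
      by rewrite addr_ge0 ?nc_ge0.
    - have -> : P \Po h - ((P \Po h)`_0)%:P = (A - (A`_0)%:P) + (E - (E`_0)%:P).
        by rewrite PhE -/A -/E coefD polyCD; ring.
      rewrite take_polyD; apply: le_trans (wnormD _ _ (ltW de0)) _.
      have := wnorm_take_le (A - (A`_0)%:P) n.+1 (ltW de0); lra.
    move=> le_b; rewrite -coef_shift -/h ncM ncX nc_real ?(ltW de0) //.
    case: (posnP k) => [->|k0]; first by rewrite expr0 mulr1; lra.
    have := coef_le_wnorm (take_poly n.+1 (h - (h`_0)%:P)) k (ltW de0).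
    rewrite coef_take_poly ltnS le_kn coefB coefC gtn_eqF // subr0; lra.
  have := @cauchy_estimate R (delta%:C ^+ k *: (G N)^`N(k)) r0 (beta + W) (n - k) (ltW r0p).
  move=> /(_ _)/wrap[] => [q qr|].
    by rewrite hornerZ mulrC; apply: taylor.
  rewrite coefZ coef_nderivn subnKC // coef_poly ltnS leq_max leqnn /=.
  rewrite ncM ncX nc_real ?(ltW de0) // -rmorphMn nc_realN normrMn.
  by apply: le_trans; rewrite le_eqVlt; apply/orP; left; apply/eqP; ring.
(* Binomial expansion of (r0 + delta/2)^n: halving [delta] turns the bounds [key] into a geometric
   series of ratio 1/2. *)
exists (2 * (beta + W)) => n; rewrite exprDn mulr_sumr.
apply: (@le_trans _ _ (\sum_(k < n.+1) (beta + W) * (1 / 2) ^+ k)); last first.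
  rewrite -mulr_sumr mulrC ler_pM2r; last by lra.
  have := @geom_sum_le R (1 / 2) n.+1 ltac:(lra).
  by have -> : (1 - 1 / 2)^-1 = 2 :> R by field.
apply: ler_sum => k _; have := key n k; rewrite -ltnS ltn_ord => /(_ isT) le_k.
have h0 : 0 <= (1 / 2 : R) ^+ k by rewrite exprn_ge0 ?divr_ge0.
have := ler_wpM2r h0 le_k; apply: le_trans.
rewrite le_eqVlt; apply/orP; left; apply/eqP.
have -> : (delta / 2) ^+ k = delta ^+ k * (1 / 2) ^+ k by rewrite -exprMn mul1r.
by rewrite mulrnAr !mulrnAl; congr (_ *+ _); ring.
Qed.
End Step.

(** The step has a gain fixed in advance on the whole annulus, so finitely many steps lead from the
    initial radius to [s]. *)
Lemma growth_lt1 s : 0 < s < 1 -> growth s.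
Proof.
move=> s01; have [s0 s1] := andP s01; have [l l0 gl] := growth_init.
have [le_sl|lt_ls] := lerP s l; first exact: growth_le (ltW s0) le_sl gl.
have [de de0 step] := @growth_step (l / 2) s (divr_gt0 l0 (ltr0n _ 2)) s01.
have iter m : growth (Num.min s (l + m%:R * (de / 2))).
  elim: m => [|m IH].
    by rewrite mul0r addr0; apply: growth_le gl; rewrite ?ge_min ?lexx ?orbT // le_min !ltW.
  set x := Num.min _ _ in IH.
  have m0 : 0 <= m%:R * (de / 2) by rewrite mulr_ge0 // divr_ge0 // ltW.
  have x0 : l <= x by rewrite le_min (ltW lt_ls) lerDl.
  have xs : x <= s by rewrite ge_min lexx.
  (* Being within de/2 below x, r0 still yields a net gain of de/2; the lower limit l/2 leaves room
     below x even when x = l. *)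
  pose r0 := Num.max (l / 2) (x - de / 2).
  have r0l : l / 2 <= r0 by rewrite le_max lexx.
  have r0x : x - de / 2 <= r0 by rewrite le_max lexx orbT.
  have r0lt : r0 < x by rewrite gt_max; apply/andP; split; lra.
  have := step r0 x r0l r0lt xs IH; apply: growth_le.
    have q0 : 0 <= m.+1%:R * (de / 2) by rewrite mulr_ge0 // divr_ge0 // ltW.
    by rewrite le_min (ltW s0) addr_ge0 // ltW.
  apply: (@le_trans _ _ (x + de / 2)); last by lra.
  rewrite /x; have [le1|lt1] := lerP s (l + m%:R * (de / 2)).
    by rewrite ge_min; apply/orP; left; lra.
  by rewrite ge_min; apply/orP; right; rewrite mulrS; lra.
have q0 : 0 <= s / (de / 2) by rewrite !divr_ge0 // ltW.
have := archi_boundP q0; set m := Num.bound _; rewrite ltr_pdivrMr ?divr_gt0 // => lt_s.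
by have := iter m; rewrite (min_idPl _) //; lra.
Qed.
End Continuation.

(** * Sign of the imaginary part on the upper half disc *)

Section ImaginaryPart.
Variable R : realType.
Variables (p : {poly R}) (kappa : R) (g : nat -> R).
Let P : {poly R[i]} := map_poly (real_complex R) p.
Let G N : {poly R[i]} := \poly_(i < N.+1) (g i)%:C.
Let J N : {poly R[i]} := \poly_(i < N.+1) (joukowski_coef R i)%:C.

Hypothesis kappa_gt0 : 0 < kappa.
Hypothesis g0 : g 0 = 0.
Hypothesis g1 : g 1 = kappa.
Hypothesis PG : forall N, eqmodXn N.+1 (P \Po G N) (kappa%:C *: J N).
Hypothesis JP : forall N, eqmodXn N.+1 ((1 + 'X^2) * J N) 'X.
Hypothesis g_growth : forall s, 0 < s < 1 -> growth g s.

Let errF N := (1 + 'X^2) * (P \Po G N) - kappa%:C *: 'X.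

(* Multiplying the equation by the conjugate of 1 + x^2 and taking imaginary
   parts. *)
Lemma nonreal_value N (x : R[i]) (s e : R) :
  0 < Im x -> nc x <= s -> s < 1 -> nc (errF N).[x] <= e ->
  4 * e <= kappa * Im x * (1 - s ^+ 2) -> Im (G N).[x] != 0.
Proof.
move=> x0 xs s1 Fe le_e; apply/eqP => w0.
have wE : (G N).[x] = (Re (G N).[x])%:C by case: (G N).[x] w0 => u v /= ->.
have := errF_horner P kappa g N x; rewrite -/(G N) -/P -/(errF N) wE /P horner_real.
move: p.[_] Fe => v; have := nc_Im (errF N).[x]; have := nc_Re (errF N).[x].
case: (errF N).[x] => c d /=; move: (Num.sqrt _) => F cF dF Fe.
have s0 : 0 <= s by apply: le_trans xs; apply: nc_ge0.
have : nc x ^+ 2 <= s ^+ 2 by rewrite lerXn2r // nnegrE ?nc_ge0.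
rewrite nc_sqr; case: x x0 {xs w0 wE} le_e => a b /= b0 le_e ab.
rewrite expr2; simpc => -[E1 E2].
have s2 : s ^+ 2 < 1 by rewrite expr_lt1.
have cE : `|c| <= e by lra.
have dE : `|d| <= e by lra.
(* Elimination of the real value v from the real and imaginary parts of (1 + x^2) v = kappa x + c +
   id. *)
have key : kappa * b * (1 - (a ^+ 2 + b ^+ 2))
   = 2 * a * b * c - (1 + a ^+ 2 - b ^+ 2) * d.
  have E3 : (2 * a * b) * ((1 + a ^+ 2 - b ^+ 2) * v) = (2 * a * b) * (kappa * a + c).
    by rewrite -E1; ring.
  have E4 : (1 + a ^+ 2 - b ^+ 2) * (2 * a * b * v) = (1 + a ^+ 2 - b ^+ 2) * (kappa * b + d).
    by rewrite -E2; ring.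
  lra.
have a2 := sqr_ge0 a; have b2 := sqr_ge0 b.
have ab1 : `|2 * a * b| <= 1.
  have := sqr_ge0 (a + b); have := sqr_ge0 (a - b); rewrite ler_norml => h1 h2.
  by apply/andP; split; lra.
have ab2 : `|1 + a ^+ 2 - b ^+ 2| <= 2 by rewrite ler_norml; apply/andP; split; lra.
have m1 : `|2 * a * b * c| <= e.
  by rewrite normrM -[leRHS]mul1r; apply: ler_pM.
have m2 : `|(1 + a ^+ 2 - b ^+ 2) * d| <= 2 * e.
  by rewrite normrM; apply: ler_pM.
have le3 : kappa * b * (1 - (a ^+ 2 + b ^+ 2)) <= 3 * e.
  rewrite key; apply: le_trans (ler_norm _) _; apply: le_trans (ler_normB _ _) _; lra.
have kb : 0 < kappa * b by rewrite mulr_gt0.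
have pos : 0 < kappa * b * (1 - s ^+ 2) by rewrite mulr_gt0 // subr_gt0.
have : kappa * b * (1 - s ^+ 2) <= kappa * b * (1 - (a ^+ 2 + b ^+ 2)).
  by rewrite ler_pM2l //; lra.
lra.
Qed.

(** On the segment from y q to q the imaginary part never vanishes, and at y q it is positive
    because G is close to kappa y q there; the intermediate value theorem carries the sign to q. *)
Lemma Im_eventually_ge0 (q : R[i]) : nc q < 1 -> 0 < Im q ->
  exists N0, forall N, (N0 <= N)%N -> 0 <= Im (G N).[q].
Proof.
move=> q1 q0; move sE: (nc q) q1 => s q1.
have s0 : 0 < s by rewrite -sE nc_gt0; apply: contraTneq q0 => ->; rewrite ltxx.
pose t := (1 + s) / 2; have t01 : 0 < t < 1 by rewrite /t; lra.
have gt := g_growth t01.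
pose u := (s + t) / 2; have u0 : 0 < u by rewrite divr_gt0 // addr_gt0 //; lra.
have su : s <= u by rewrite /u /t; lra.
have ut : u < t by rewrite /u /t; lra.
have [A [A0 AP]] := @wnorm_G R g u t (ltW u0) ut gt.
pose D N := G N - kappa%:C *: 'X.
have DP N : wnorm u (D N) <= A + kappa * u.
  apply: le_trans (wnormB _ _ (ltW u0)) _; apply: lerD; first exact: AP.
  by rewrite wnormZ wnormX nc_real // ltW.
pose B := A + kappa * u.
have B0 : 0 <= B by rewrite addr_ge0 // mulr_ge0 ?ltW.
have u2 : 0 < u ^+ 2 by rewrite exprn_gt0.
(* At y q the part of G of order at least 2 is bounded by y^2 B / u^2, which this choice keeps
   within half of kappa y Im q. *)
pose y := Num.min 1 (kappa * Im q * u ^+ 2 / (2 * (B + 1))).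
have y0 : 0 < y by rewrite lt_min ltr01 !(divr_gt0, mulr_gt0) //; lra.
have y1 : y <= 1 by rewrite ge_min lexx.
have yB : y * B <= kappa * Im q * u ^+ 2 / 2.
  have : y <= kappa * Im q * u ^+ 2 / (2 * (B + 1)) by rewrite ge_min lexx orbT.
  by rewrite ler_pdivlMr; [nra | lra].
have s2 : 0 < 1 - s ^+ 2 by rewrite subr_gt0 expr_lt1 // ltW.
(* The tolerance needed at the lowest point y q serves on the whole segment, since Im (z q) grows
   with z. *)
pose e := kappa * (y * Im q) * (1 - s ^+ 2) / 4.
have e0 : 0 < e by rewrite divr_gt0 // !mulr_gt0.
have st : s < t by rewrite /t; lra.
have [N0 N0P] := errF_small kappa_gt0 PG JP (ltW s0) st gt e0.
exists (maxn N0 1) => N; rewrite geq_max => /andP[/N0P {}N0P N1].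
(* Along the ray through q, Im G is a real polynomial in the scaling factor. *)
pose S := \poly_(n < N.+1) (g n * Im (q ^+ n)).
have SE z : S.[z] = Im (G N).[z%:C * q].
  rewrite horner_poly /G horner_poly raddf_sum /=; apply: eq_bigr => i _.
  rewrite exprMn -rmorphXn mulrA -rmorphM /=; case: (q ^+ i) => a b /=; ring.
have Im_scale (z : R) : Im (z%:C * q) = z * Im q by case: (q) => a b /=; ring.
have nz z : y <= z <= 1 -> S.[z] != 0.
  move=> /andP[yz z1]; have z0 : 0 < z by lra.
  have zq : nc (z%:C * q) <= s.
    by rewrite ncM sE nc_real ?(ltW z0) // -[leRHS]mul1r ler_pM2r.
  rewrite SE; apply: (@nonreal_value N _ s e) => //.
  - by rewrite Im_scale mulr_gt0.
  - apply: le_trans (nc_horner _ _) (le_trans (wnorm_le _ (nc_ge0 _) zq) N0P).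
  have -> : 4 * e = kappa * (y * Im q) * (1 - s ^+ 2) by rewrite /e; field.
  by rewrite Im_scale ler_pM2r // ler_pM2l // ler_pM2r.
have Sy : 0 < S.[y].
  have GD : (G N).[y%:C * q] = (kappa * y)%:C * q + (D N).[y%:C * q].
    by rewrite hornerD hornerN hornerZ hornerX rmorphM mulrA addrC subrK.
  have le_D : nc (D N).[y%:C * q] <= y * (kappa * Im q) / 2.
    have yq : nc (y%:C * q) = y * s by rewrite ncM sE nc_real // ltW.
    have ys : 0 <= y * s by rewrite mulr_ge0 // ltW.
    have ysu : y * s <= u by apply: le_trans su; rewrite -[leRHS]mul1r ler_pM2r.
    apply: le_trans (nc_horner _ _) _; rewrite yq -(ler_pM2r u2).
    have D0 i : (i < 2)%N -> (D N)`_i = 0.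
      case: i => [|[|//]] _; rewrite coefB coefZ coefX coef_poly ?ltnS ?N1 /=.
        by rewrite g0 mulr0 subr0.
      by rewrite g1 mulr1 subrr.
    apply: le_trans (wnorm_drop ys ysu D0) _.
    have h1 : wnorm u (D N) <= B by apply: DP.
    have h2 : (y * s) ^+ 2 <= y ^+ 2.
      by rewrite lerXn2r ?nnegrE // ?(ltW y0) // -[leRHS]mulr1 ler_pM2l // ltW.
    apply: (@le_trans _ _ (y ^+ 2 * B)).
      by apply: ler_pM; rewrite ?exprn_ge0 ?wnorm_ge0 // ltW.
    have := ler_wpM2l (ltW y0) yB; rewrite expr2; lra.
  rewrite SE GD.
  have := le_trans (nc_Im _) le_D; case: (D N).[_] => a b /=.
  have -> : Im ((kappa * y)%:C * q + a +i* b) = kappa * y * Im q + b.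
    by case: (q) => a' b' /=; ring.
  have : 0 < y * (kappa * Im q) by rewrite !mulr_gt0.
  rewrite ler_norml => h /andP[]; lra.
have qE : q = 1%:C * q by rewrite mul1r.
rewrite qE -SE leNgt; apply/negP => S1.
have [|z] := @polyrcf.poly_ivt R S y 1 y1; first by rewrite mulr_ge0_le0 // ltW.
by rewrite in_itv /= => /nz/eqP Sz /rootP.
Qed.
End ImaginaryPart.

(** * Critical values and the choice of kappa *)

Section Instantiation.
Variables (R : realType) (r : nat) (a : nat -> R).
Local Notation cpoly := (map_poly (real_complex R)).

Lemma P_polyE : P_poly r a = cpoly (realP r a).
Proof.
rewrite /P_poly /realP rmorphB rmorph_sum /= map_polyX; congr (_ - _).
by apply: eq_bigr => j _; rewrite map_polyZ map_polyXn.
Qed.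

Lemma realP_coef1 : (realP r a)`_1 = 1.
Proof.
rewrite coefB coefX coef_sum big_nat big1 ?subr0 // => j /andP[j2 _].
by rewrite coefZ coefXn ltn_eqF // mulr0.
Qed.

Lemma mup_ge2 (P : {poly R[i]}) x : P != 0 -> root P x -> root P^`() x ->
  (2 <= mup x P)%N.
Proof.
move=> P0 Px P'x; rewrite mup_geq //.
have /factor_theorem[u PE] := Px.
have : root u x.
  move: P'x; rewrite PE derivM derivXsubC mulr1 rootE !hornerE subrr mulr0 add0r.
  by rewrite rootE.
by case/factor_theorem => v uE; rewrite PE uE -mulrA expr2 dvdp_mulIr.
Qed.

(** A critical point x is a multiple root of P - P(x), so P(x) belongs to [N_set]. *)
Lemma crit_value_real x : N_set r a `<=` [set z | z \is Num.real] ->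
  root (P_poly r a)^`() x -> exists v : R, (P_poly r a).[x] = v%:C.
Proof.
move=> Nreal P'x; set z := (P_poly r a).[x].
suff /Nreal/complex_realP[v ->] : N_set r a z by exists v.
exists x; apply: mup_ge2.
- apply/eqP => /(congr1 (fun p : {poly R[i]} => p`_1)).
  rewrite coefB coefC subr0 coef0 P_polyE coef_map realP_coef1 => /eqP.
  by rewrite oner_eq0.
- by rewrite rootE hornerD hornerN hornerC subrr.
- by rewrite derivB derivC subr0.
Qed.

(** Applied to the finitely many critical values; the nonzero ones are bounded away from 0. *)
Lemma exists_kappa (vs : seq R[i]) : exists2 kappa : R, 0 < kappa &
  forall x, x \in vs -> (x == 0) || (kappa <= 2 * nc x).
Proof.
elim: vs => [|x vs [k k0 kP]]; first by exists 1.
have [->|x0] := eqVneq x 0.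
  by exists k => // y; rewrite inE => /predU1P[->|/kP //]; rewrite eqxx.
exists (Num.min k (2 * nc x)); first by rewrite lt_min k0 mulr_gt0 // nc_gt0.
move=> y; rewrite inE => /predU1P[->|/kP/orP[->//|le_k]].
  by rewrite ge_min lexx !orbT.
by rewrite ge_min le_k !orbT.
Qed.

Lemma eqmodXn_map n (p q : {poly R}) :
  eqmodXn n p q -> eqmodXn n (cpoly p) (cpoly q).
Proof. by move=> pq i lt_in; rewrite !coef_map pq. Qed.

Lemma cpoly_poly N (E : nat -> R) :
  cpoly (\poly_(i < N) E i) = \poly_(i < N) (E i)%:C.
Proof. by apply/polyP => i; rewrite coef_map !coef_poly; case: ifP. Qed.

Lemma bseq_ge0 : N_set r a `<=` [set z | z \is Num.real] ->
  exists2 kappa : R, 0 < kappa & forall Q : {poly R}, (forall t, 0 <= Q.[t]) ->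
    0 <= Lam (bseq r a kappa) Q.
Proof.
move=> Nreal; have PE := P_polyE; set P := P_poly r a in PE.
have P1 : P`_1 = 1 by rewrite PE coef_map realP_coef1.
have szP : (1 < size P)%N.
  rewrite ltnNge; apply/negP => le_P; have := P1; rewrite nth_default // => /esym/eqP.
  by rewrite oner_eq0.
have P'0 : P^`().[0] = 1 by rewrite horner_coef0 coef_deriv P1.
have P'n0 : P^`() != 0.
  by apply/eqP => e; have := P'0; rewrite e horner0 => /esym/eqP; rewrite oner_eq0.
have [rs rsE] := closed_field_poly_normal P^`().
have [k k0 kP] := exists_kappa [seq P.[x] | x <- rs].
exists k => //.
have crit x : root P^`() x ->
    exists2 v : R, P.[x] = v%:C & (v == 0) || (k <= 2 * `|v|).
  move=> P'x; have [v vE] := crit_value_real Nreal P'x; exists v => //.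
  have x_rs : P.[x] \in [seq P.[x] | x <- rs].
    apply: map_f; move: P'x; rewrite rsE rootZ ?lead_coef_eq0 //.
    by rewrite root_prod_XsubC.
  by have := kP _ x_rs; rewrite -/P in vE *; rewrite vE nc_realN (inj_eq (@complexI R)).
pose g := gseq r a k.
have PG N : eqmodXn N.+1 (P \Po \poly_(i < N.+1) (g i)%:C)
    (k%:C *: \poly_(i < N.+1) (joukowski_coef R i)%:C).
  have := eqmodXn_map (@realP_gpoly R r a k N).
  by rewrite map_comp_poly map_polyZ /= !cpoly_poly -PE.
have JP N : eqmodXn N.+1 ((1 + 'X^2) * \poly_(i < N.+1) (joukowski_coef R i)%:C) 'X.
  have := eqmodXn_map (@joukowskiP R N).
  by rewrite rmorphM rmorphD rmorph1 /= !map_polyXn map_polyX cpoly_poly.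
have g0 : g 0 = 0 := gseq0 r a k.
have g1 : g 1 = k := gseq1 r a k.
have gr s : 0 < s < 1 -> growth g s := growth_lt1 k0 g0 szP P'0 PG JP crit (s := s).
apply: (@Lam_ge0 R _ g).
- by move=> n; apply: gseq_chebV.
- exact: gr.
move=> q q1 q0; have PG' := PG; rewrite PE in PG'.
have [N0 N0P] := Im_eventually_ge0 k0 g0 g1 PG' JP gr q1 q0.
by exists N0 => N /N0P; rewrite cpoly_poly.
Qed.
End Instantiation.

Theorem theorem2p5 (R : realType) (r : nat) (a : nat -> R) :
  (2 <= r)%N -> a r != 0 ->
  N_set r a `<=` [set z | z \is Num.real] ->
  positive_definite (c_seq r a).
Proof.
move=> _ _ /bseq_ge0[k k0 b_ge0] x m _.
(* The moments carry the factor k^(i+1); dividing by k^i leaves a single factor [k] in front of the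
   quadratic form, which becomes [Lam] of a square. *)
pose y i := x i / k ^+ i.
pose p := \sum_(i < m) y i *: 'X^i.
have sz_p : (size p <= m)%N.
  apply: (leq_trans (size_sum _ _ _)); apply/bigmax_leqP => i _.
  by apply: (leq_trans (size_scale_leq _ _)); rewrite size_polyXn.
have sz_p2 : (size (p ^+ 2)%R <= 2 * m)%N.
  rewrite expr2 mul2n -addnn; apply: leq_trans (size_polyMleq _ _) _.
  by apply: leq_trans (leq_pred _) _; rewrite leq_add.
have p2_ge0 t : 0 <= (p ^+ 2).[t] by rewrite horner_exp sqr_ge0.
have := b_ge0 _ p2_ge0; rewrite (LamE _ sz_p2).
suff -> : \sum_(i < 2 * m) (p ^+ 2)`_i * bseq r a k i
    = k * \sum_(i < m) \sum_(j < m) c_seq r a (i + j) * x i * x j.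
  by rewrite pmulr_rge0.
have pE : p ^+ 2 = \sum_(i < m) \sum_(j < m) (y i * y j) *: 'X^(i + j).
  rewrite expr2 mulr_suml; apply: eq_bigr => i _; rewrite mulr_sumr.
  by apply: eq_bigr => j _; rewrite -scalerAl -scalerAr scalerA exprD.
under eq_bigr => n _ do rewrite pE coef_sum mulr_suml.
rewrite exchange_big mulr_sumr; apply: eq_bigr => i _.
under eq_bigr => n _ do rewrite coef_sum mulr_suml.
rewrite exchange_big mulr_sumr; apply: eq_bigr => j _.
have lt_ij : (i + j < 2 * m)%N.
  by rewrite mul2n -addnn -addSn; apply: leq_add => //; apply: ltnW.
rewrite (bigD1 (Ordinal lt_ij)) //= coefZ coefXn eqxx mulr1 big1 => [|n ne_n].
  rewrite addr0 /bseq /y exprS exprD; field.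
  by rewrite !expf_neq0 // gt_eqF.
rewrite coefZ coefXn; case: eqP => [e|_]; last by rewrite mulr0 mul0r.
by case/eqP: ne_n; apply: val_inj.
Qed.
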